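(* Let $m>0$ and let $A$ be the operator on $X=H^1(\mathbb{R})\times L^2(\mathbb{R})$ defined in the context. The following hold: (a) $A$ is closed; (b) $A$ is dissipative; (c) $\sigma(A)\cap i\mathbb{R}=\{i\sqrt{m},-i\sqrt{m}\}$; (d) $\sigma_p(A)\cap i\mathbb{R}=\emptyset$.
   Context: Fix a constant $m>0$. Let $X=H^1(\mathbb{R})\times L^2(\mathbb{R})$ (complex-valued functions), a complex Hilbert space with norm $$\|z\|_X^2=m\|u\|_{L^2(\mathbb{R})}^2+\|u'\|_{L^2(\mathbb{R})}^2+\|v\|_{L^2(\mathbb{R})}^2,\qquad z=(u,v)\in X,$$ and the corresponding inner product. Let $A:D(A)\subseteq X\to X$ be the linear operator $$A(u,v)=(v,\,(u+v)''-mu),\qquad D(A)=\{(u,v)\in H^1(\mathbb{R})\times H^1(\mathbb{R}): u+v\in H^2(\mathbb{R})\}.$$ Here $\sigma(A)$ denotes the spectrum and $\sigma_p(A)$ the point spectrum (set of eigenvalues) of $A$; dissipative means $\operatorname{Re}\langle Az,z\rangle_X\le0$ for all $z\in D(A)$. *)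

(* Defs.v *)
From HB Require Import structures.
From mathcomp Require Import all_boot all_order all_algebra.
From mathcomp Require Import generic_quotient ring_quotient.
From mathcomp Require Import all_classical all_reals all_analysis.
From mathcomp Require Import measurable_realfun.
From mathcomp Require Import complex.

Set Implicit Arguments.
Unset Strict Implicit.
Unset Printing Implicit Defensive.

Import Order.TTheory GRing.Theory Num.Theory.
Import numFieldNormedType.Exports.

Local Open Scope classical_set_scope.
Local Open Scope ring_scope.
Local Open Scope complex_scope.
Local Open Scope quotient_scope.

Section ComplexL2.
Variable R : realType.
Local Notation mu := (@lebesgue_measure R).
Local Notation Lfun2 := (Lfun mu 2%:E).
Local Notation Re := (@complex.Re R).
Local Notation Im := (@complex.Im R).

(* Lebesgue integral of a complex-valued function; it is only meaningful when
   the real and imaginary parts are integrable, as [Rintegral] returns an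
   arbitrary finite value otherwise. *)
Definition cintegral (f : R -> R[i]) : R[i] :=
  (\int[mu]_x Re (f x))%R +i* (\int[mu]_x Im (f x))%R.

(* Since |f|^2 = (Re f)^2 + (Im f)^2, this says that f is measurable and that
   |f|^2 is integrable. *)
Definition sqint_pred : {pred R -> R[i]} :=
  fun f => (Re \o f \in Lfun2) && (Im \o f \in Lfun2).

Record sqint : Type := Sqint
  { sqint_val :> R -> R[i]; sqintP : sqint_val \in sqint_pred }.

HB.instance Definition _ := [isSub for sqint_val].
HB.instance Definition _ := [Choice of sqint by <:].

Lemma Lfun2_comb (a b : R) (f g : R -> R) :
  f \in Lfun2 -> g \in Lfun2 -> (fun x => a * f x + b * g x) \in Lfun2.
Proof.
have [L0 LD] := Lfun_submod_closed mu (lee1n 2).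
move=> fL gL.
have bg : b *: g \in Lfun2 by rewrite -[b *: g]addr0; exact: LD.
exact: (LD a f (b *: g)).
Qed.

Lemma sqint_submod_closed : submod_closed sqint_pred.
Proof.
have [L0 _] := Lfun_submod_closed mu (lee1n 2).
split; first by apply/andP; split; exact: L0.
move=> a f g /andP[fr fi] /andP[gr gi]; apply/andP; split.
- have -> : Re \o (a *: f + g) =
    (fun x => 1 * (Re a * Re (f x) + (- Im a) * Im (f x)) + 1 * Re (g x)).
    apply/funext => x /=; rewrite !mul1r.
    have -> : (a *: f + g) x = a * f x + g x by [].
    by case: (a) (f x) (g x) => [? ?] [? ?] [? ?] /=; rewrite mulNr.
  by apply: Lfun2_comb => //; exact: Lfun2_comb.
- have -> : Im \o (a *: f + g) =
    (fun x => 1 * (Re a * Im (f x) + Im a * Re (f x)) + 1 * Im (g x)).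
    apply/funext => x /=; rewrite !mul1r.
    have -> : (a *: f + g) x = a * f x + g x by [].
    by case: (a) (f x) (g x) => [? ?] [? ?] [? ?] /=.
  by apply: Lfun2_comb => //; exact: Lfun2_comb.
Qed.

HB.instance Definition _ :=
  GRing.isSubmodClosed.Build _ _ sqint_pred sqint_submod_closed.
HB.instance Definition _ := [SubChoice_isSubLmodule of sqint by <:].

Definition null_pred : {pred sqint} := fun f => `[< {ae mu, forall x, f x = 0} >].

Lemma null_submod_closed : submod_closed null_pred.
Proof.
split; first by apply/asboolP/aeW.
move=> a f g /asboolP f0 /asboolP g0; apply/asboolP.
have FF := ae_filter_ringOfSetsType mu.
move: f0 g0; apply: filterS2 => x fx gx.
have -> : (a *: f + g) x = a * f x + g x by [].
by rewrite fx gx mulr0 addr0.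
Qed.

HB.instance Definition _ :=
  GRing.isSubmodClosed.Build _ _ null_pred null_submod_closed.

(* L^2(R; C) is the quotient of the square-integrable functions by the subspace
   of those vanishing almost everywhere; [L2fun f] is a chosen representative
   of the class f. *)
Definition L2 : Type := Quotient.quot null_pred.
HB.instance Definition _ := GRing.Zmodule.on L2.
HB.instance Definition _ := EqQuotient.on L2.

Definition L2fun (f : L2) : R -> R[i] := repr f.
Coercion L2fun : L2 >-> Funclass.

Definition scaleL2 (a : R[i]) : L2 -> L2 := lift_op1 L2 ( *:%R a).

Lemma pi_scaleL2 a : {morph \pi_L2 : f / a *: f >-> scaleL2 a f}.
Proof.
move=> f; unlock scaleL2; apply/eqP.
rewrite -Quotient.idealrBE -scalerBr rpredZ //.
by rewrite Quotient.idealrBE reprK.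
Qed.
Canonical pi_scaleL2_morph a := PiMorph1 (pi_scaleL2 a).

Fact scaleL2A a b f : scaleL2 a (scaleL2 b f) = scaleL2 (a * b) f.
Proof. by rewrite -[f]reprK !piE scalerA. Qed.

Fact scaleL21 : left_id 1 scaleL2.
Proof. by move=> f; rewrite -[f]reprK !piE scale1r. Qed.

Fact scaleL2Dr : right_distributive scaleL2 +%R.
Proof. by move=> a f g; rewrite -[f]reprK -[g]reprK !piE scalerDr. Qed.

Fact scaleL2Dl f : {morph scaleL2^~ f : a b / a + b}.
Proof. by move=> a b; rewrite -[f]reprK !piE scalerDl. Qed.

HB.instance Definition _ :=
  GRing.Zmodule_isLmodule.Build R[i] L2 scaleL2A scaleL21 scaleL2Dr scaleL2Dl.

Lemma L2fun_lin a (f g : L2) :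
  {ae mu, forall x, (a *: f + g : L2) x = a * f x + g x}.
Proof.
have : a *: repr f + repr g = repr (a *: f + g) %[mod L2].
  rewrite reprK; transitivity (\pi_L2 (a *: repr f) + \pi_L2 (repr g)).
    exact: Quotient.pi_add.
  by rewrite pi_scaleL2 !reprK.
move/eqP; rewrite -Quotient.idealrBE => /asboolP.
have FF := ae_filter_ringOfSetsType mu.
apply: filterS => x fgx.
have /eqP : (a * repr f x + repr g x) - repr (a *: f + g) x = 0 := fgx.
by rewrite subr_eq0 => /eqP.
Qed.

Definition cintegrable (f : R -> R[i]) : Prop :=
  mu.-integrable setT (EFin \o (Re \o f)) /\
  mu.-integrable setT (EFin \o (Im \o f)).

Lemma Rintegral_lin (a b : R) (f g : R -> R) :
  mu.-integrable setT (EFin \o f) -> mu.-integrable setT (EFin \o g) ->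
  mu.-integrable setT (EFin \o (fun x => a * f x + b * g x)) /\
  (\int[mu]_x (a * f x + b * g x) =
   a * \int[mu]_x f x + b * \int[mu]_x g x)%R.
Proof.
move=> intf intg.
have intZ c h : mu.-integrable setT (EFin \o h) ->
    mu.-integrable setT (EFin \o (fun x => c * h x)).
  by move=> inth; apply: (integrableZl _ c inth).
split; first exact: (integrableD measurableT (intZ a f intf) (intZ b g intg)).
by rewrite RintegralD ?RintegralZl//; exact: intZ.
Qed.

Lemma cintegral_lin (a : R[i]) (f g : R -> R[i]) :
  cintegrable f -> cintegrable g ->
  cintegrable (fun x => a * f x + g x) /\
  cintegral (fun x => a * f x + g x) = a * cintegral f + cintegral g.
Proof.
move=> [fr fi] [gr gi].
have reE : Re \o (fun x => a * f x + g x) =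
    (fun x => 1 * (Re a * Re (f x) + (- Im a) * Im (f x)) + 1 * Re (g x)).
  apply/funext => x /=; rewrite !mul1r.
  by case: (a) (f x) (g x) => [? ?] [? ?] [? ?] /=; rewrite mulNr.
have imE : Im \o (fun x => a * f x + g x) =
    (fun x => 1 * (Re a * Im (f x) + Im a * Re (f x)) + 1 * Im (g x)).
  apply/funext => x /=; rewrite !mul1r.
  by case: (a) (f x) (g x) => [? ?] [? ?] [? ?] /=.
have [ir1 er1] := Rintegral_lin (Re a) (- Im a) fr fi.
have [ir er] := Rintegral_lin 1 1 ir1 gr.
have [ii1 ei1] := Rintegral_lin (Re a) (Im a) fi fr.
have [ii ei] := Rintegral_lin 1 1 ii1 gi.
split; first by split; rewrite ?reE ?imE.
have -> : cintegral (fun x => a * f x + g x) =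
    (\int[mu]_x (Re \o (fun x => a * f x + g x)) x)%R +i*
    (\int[mu]_x (Im \o (fun x => a * f x + g x)) x)%R by [].
rewrite reE imE er er1 ei ei1 !mul1r /cintegral.
by case: a {reE imE ir1 er1 ir er ii1 ei1 ii ei} => p q /=; rewrite mulNr.
Qed.

Lemma ae_eq_cintegral (f g : R -> R[i]) :
  measurable_fun setT (Re \o f) -> measurable_fun setT (Im \o f) ->
  measurable_fun setT (Re \o g) -> measurable_fun setT (Im \o g) ->
  {ae mu, forall x, f x = g x} -> cintegral f = cintegral g.
Proof.
move=> mfr mfi mgr mgi fg; rewrite /cintegral /Rintegral.
have FF := ae_filter_ringOfSetsType mu.
congr (fine _ +i* fine _); apply: ae_eq_integral => //;
  try exact/measurable_EFinP; by apply: filterS fg => x /= ->.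
Qed.

Lemma sqint_mul (f g : R -> R[i]) : f \in sqint_pred -> g \in sqint_pred ->
  cintegrable (fun x => f x * g x).
Proof.
move=> /andP[fr fi] /andP[gr gi].
have intM h k : h \in Lfun2 -> k \in Lfun2 ->
    mu.-integrable setT (EFin \o (fun x => h x * k x)).
  by move=> hL kL; apply/Lfun1_integrable; exact: Lfun2_mul_Lfun1.
split.
- rewrite (_ : Re \o _ = fun x => 1 * ((Re \o f) x * (Re \o g) x) +
    (-1) * ((Im \o f) x * (Im \o g) x)).
    by apply: (Rintegral_lin _ _ _ _).1; exact: intM.
  by apply/funext => x /=; case: (f x) (g x) => [? ?] [? ?] /=; rewrite mul1r mulN1r.
- rewrite (_ : Im \o _ = fun x => 1 * ((Re \o f) x * (Im \o g) x) +
    1 * ((Im \o f) x * (Re \o g) x)).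
    by apply: (Rintegral_lin _ _ _ _).1; exact: intM.
  by apply/funext => x /=; case: (f x) (g x) => [? ?] [? ?] /=; rewrite !mul1r.
Qed.

Lemma L2fun_sqint (f : L2) : L2fun f \in sqint_pred.
Proof. exact: sqintP. Qed.

Lemma cintegral_L2_lin a (f g : L2) (h : R -> R[i]) : h \in sqint_pred ->
  cintegral (fun x => (a *: f + g : L2) x * h x) =
  a * cintegral (fun x => f x * h x) + cintegral (fun x => g x * h x).
Proof.
move=> hL.
have intL k := sqint_mul (L2fun_sqint k) hL.
have [il <-] := cintegral_lin a (intL f) (intL g).
have meas k : mu.-integrable setT (EFin \o k) -> measurable_fun setT k.
  by move=> /integrableP[/measurable_EFinP].
have [lr li] := il; have [kr ki] := intL (a *: f + g).
apply: ae_eq_cintegral; [exact: meas..|].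
have FF := ae_filter_ringOfSetsType mu.
by apply: filterS (L2fun_lin a f g) => x ->; rewrite mulrDl mulrA.
Qed.

(* Real-valued test functions suffice: by linearity of the integral, testing
   against C_c^oo(R; C) gives the same notion of weak derivative. *)
Definition test_function (phi : R -> R) : Prop :=
  (forall n x, derivable (phi^`(n)%classic) x 1) /\
  compact (closure [set x | phi x != 0]).

Definition weak_derivative (f g : L2) : Prop :=
  forall phi : R -> R, test_function phi ->
    cintegral (fun x => f x * (phi^`()%classic x)%:C) =
    - cintegral (fun x => g x * (phi x)%:C).

Lemma testfun_L2 (phi : R -> R) (K : set R) : compact K -> continuous phi ->
  (forall x, ~ K x -> phi x = 0) -> phi \in Lfun2.
Proof.
move=> cK cphi phi0.
have mphi : measurable_fun setT phi by exact: continuous_measurable_fun.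
have csq : continuous (fun x => phi x ^+ 2).
  by move=> x; apply: cvgM; exact: cphi.
have iK : mu.-integrable K (EFin \o (fun x => phi x ^+ 2)).
  by apply: continuous_compact_integrable => //; exact: continuous_subspaceT.
have mK : measurable (K : set (measurableTypeR R)) by exact: compact_measurable.
have {iK} := (integrable_mkcond _ mK).1 iK.
rewrite (_ : _ \_ _ = EFin \o (fun x => phi x ^+ 2)); last first.
  apply/funext => x /=; rewrite patchE; case: ifPn => // /negP xK.
  by rewrite /= phi0 ?expr0n// => Kx; apply: xK; rewrite inE.
move=> /integrableP[_ iphi].
rewrite inE; apply/andP; split; rewrite inE //=.
rewrite /finite_norm unlock poweR_lty //=.
apply: le_lt_trans iphi; rewrite le_eqVlt; apply/orP; left; apply/eqP.
apply: eq_integral => x _ /=.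
by rewrite powR_mulrn// normrX.
Qed.

Lemma test_function_L2 phi : test_function phi ->
  phi \in Lfun2 /\ phi^`()%classic \in Lfun2.
Proof.
move=> [dphi cK]; set K := closure _ in cK.
have phi0 x : ~ K x -> phi x = 0.
  by apply: contra_notP => /eqP ?; exact: subset_closure.
have cphi : continuous phi.
  by move=> x; apply/differentiable_continuous/derivable1_diffP/(dphi 0%N).
have cdphi : continuous (phi^`()%classic).
  by move=> x; apply/differentiable_continuous/derivable1_diffP/(dphi 1%N).
split; first exact: testfun_L2 cK cphi phi0.
apply: testfun_L2 cK cdphi _ => x xK; rewrite derive1E.
rewrite (@near_eq_derive _ _ _ _ (cst 0)) ?derive_cst//.
have oK : open (~` K) by apply: closed_openC; exact: closed_closure.
near=> y; apply: phi0; near: y; exact: open_nbhs_nbhs.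
Unshelve. all: by end_near. Qed.

Lemma real_sqint (h : R -> R) : h \in Lfun2 -> (fun x => (h x)%:C) \in sqint_pred.
Proof.
move=> hL; apply/andP; split => //.
by have [L0 _] := Lfun_submod_closed mu (lee1n 2); exact: L0.
Qed.

Definition H1_pred : {pred L2} := fun u => `[< exists g, weak_derivative u g >].

Lemma H1_submod_closed : submod_closed H1_pred.
Proof.
have lin a f f' g g' : weak_derivative f f' -> weak_derivative g g' ->
    weak_derivative (a *: f + g) (a *: f' + g').
  move=> ff' gg' phi tphi; have [phiL dphiL] := test_function_L2 tphi.
  rewrite !cintegral_L2_lin; try exact: real_sqint.
  by rewrite ff' // gg' // mulrN -opprD.
split; last first.
  move=> a f g /asboolP[f' ff'] /asboolP[g' gg']; apply/asboolP.
  by exists (a *: f' + g'); exact: lin.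
apply/asboolP; exists 0 => phi tphi; have [phiL dphiL] := test_function_L2 tphi.
have zero h : h \in Lfun2 -> cintegral (fun x => (0 : L2) x * (h x)%:C) = 0.
  move=> /real_sqint hL; have := cintegral_L2_lin 1 0 0 hL.
  by rewrite scaler0 addr0 mul1r => /esym/eqP; rewrite addrC -subr_eq0 addrK => /eqP.
by rewrite !zero// oppr0.
Qed.

HB.instance Definition _ :=
  GRing.isSubmodClosed.Build _ _ H1_pred H1_submod_closed.

Record H1 : Type := MkH1 { H1val :> L2; H1P : H1val \in H1_pred }.

HB.instance Definition _ := [isSub for H1val].
HB.instance Definition _ := [Choice of H1 by <:].
HB.instance Definition _ := [SubChoice_isSubLmodule of H1 by <:].

(* The weak derivative is unique in L^2, so [wderiv u] is u' when u is in H^1;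
   it is 0 outside of H^1. *)
Definition wderiv (u : L2) : L2 := xget 0 [set g | weak_derivative u g].

Definition H2_pred : {pred L2} :=
  fun w => `[< exists g h, weak_derivative w g /\ weak_derivative g h >].

(* Inner products are linear in the first argument. *)
Definition dotL2 (f g : L2) : R[i] := cintegral (fun x => f x * (g x)^*).

End ComplexL2.

(* Possibly unbounded operators in a space V whose norm comes from the inner
   product [dot]. *)
Section Operators.
Variables (R : realType) (V : lmodType R[i]) (dot : V -> V -> R[i]).

(* Only the values of [app] on [dom] are meaningful. *)
Record operator := Operator { dom : set V; app :> V -> V }.

Definition dot_norm (z : V) : R := Num.sqrt (complex.Re (dot z z)).

Definition dot_cvg (z_ : nat -> V) (z : V) : Prop :=
  dot_norm (z_ n - z) @[n --> \oo] --> (0 : R).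

Definition closed_operator (A : operator) : Prop :=
  forall (z_ : nat -> V) (z w : V), (forall n, dom A (z_ n)) ->
    dot_cvg z_ z -> dot_cvg (A \o z_) w -> dom A z /\ A z = w.

Definition dissipative (A : operator) : Prop :=
  forall z, dom A z -> complex.Re (dot (A z) z) <= 0.

Definition bounded_operator (S : V -> V) : Prop :=
  exists M : R, forall z, dot_norm (S z) <= M * dot_norm z.

(* l is in the resolvent set when l - A is a bijection from dom A onto V with a
   bounded inverse S. *)
Definition resolvent_set (A : operator) : set R[i] :=
  [set l | exists S : {linear V -> V},
    [/\ bounded_operator S,
        forall w, dom A (S w) /\ l *: S w - A (S w) = w &
        forall z, dom A z -> S (l *: z - A z) = z]].

Definition spectrum (A : operator) : set R[i] := ~` resolvent_set A.

Definition point_spectrum (A : operator) : set R[i] :=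
  [set l | exists z, [/\ dom A z, z != 0 & A z = l *: z]].

End Operators.

Section DampedWave.
Variables (R : realType) (m : R).

Definition Xspace : Type := (H1 R * L2 R)%type.

Definition dotX (z w : Xspace) : R[i] :=
  m%:C * dotL2 z.1 w.1 + dotL2 (wderiv z.1) (wderiv w.1) + dotL2 z.2 w.2.

(* Here z = (u, v). As z.1 is already in H^1(R) by typing, the domain asks for
   v in H^1(R) and u + v in H^2(R). The first component of A z is v, seen as an
   element of H^1(R); [insubd] would return 0 for v outside of H^1(R). *)
Definition opA : operator Xspace :=
  Operator
    [set z : Xspace | z.2 \in @H1_pred R /\ (z.1 : L2 R) + z.2 \in @H2_pred R]
    (fun z => (insubd 0 z.2,
               wderiv (wderiv ((z.1 : L2 R) + z.2)) - m%:C *: (z.1 : L2 R))).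

End DampedWave.

Definition imaginary_axis (R : realType) : set R[i] :=
  [set l | complex.Re l = 0].
Arguments imaginary_axis : clear implicits.

(* Main.v *)
Require Import Defs.
From HB Require Import structures.
From mathcomp Require Import all_boot all_order all_algebra.
From mathcomp Require Import generic_quotient ring_quotient.
From mathcomp Require Import all_classical all_reals all_analysis.
From mathcomp Require Import measurable_realfun.
From mathcomp Require Import complex ring lra.
Import Order.TTheory GRing.Theory Num.Theory.
Import numFieldNormedType.Exports.

Set Implicit Arguments.
Unset Strict Implicit.
Unset Printing Implicit Defensive.

Local Open Scope classical_set_scope.
Local Open Scope ring_scope.
Local Open Scope complex_scope.
Local Open Scope quotient_scope.

(* The weak derivative D on L^2(R) is the adjoint of differentiation on test
   functions.  As an L^2 solution of f' = f or f' = -f vanishes (correlating f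
   with a test function gives a bounded smooth solution of the same equation),
   D is skew-adjoint; hence k + D is onto with bounded inverse for Re k <> 0, and
   so is c - D^2 = (k - D) (k + D) when k^2 = c is not a nonpositive real.

   Dissipativity is the identity Re <A z, z> = - ||v'||^2, and closedness of A
   follows from that of D.  If A z = l z with Re l = 0, the identity forces
   v' = 0, so v = 0, and then u = 0.  With w = u + v, the equation
   l z - A z = (f, g) becomes
     - w'' + c w = g + (l - c) f,   c = (l^2 + m) / (1 + l),
   which is solvable on the imaginary axis unless c = 0, that is l^2 = -m.  In
   that case l z - A z = (0, b) asks for w'' = - b in L^2, which is impossible for
   a bump b. *)

(** Integration by parts between arbitrary elements of H^1 is usually reached through the density of
    test functions. Here duality alone gives it: [weak_derivative] extends differentiation on test
    functions, and it is itself skew as soon as no nonzero f in L^2 solves f' = f or f' = -f.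
    Correlation settles this because F(t) = int f(x) phi(x - t) dx is differentiable for every f in
    L^2, and the weak equation for f is a classical one for F, whose solutions are exponentials.

    The factor 1 + l comes from v = l u - f, that is u + v = (1 + l) u - f; it vanishes only at l =
    -1, away from the imaginary axis. The two exceptional values are spectral without being
    eigenvalues: at c = 0 one has to invert -D^2, which is injective but not onto, and the lower
    bound |Re k| that controls the inverse of k + D degenerates. *)

(** * Inner products, orthogonal projection and skew-adjoint relations *)

Section InnerProduct.
Variables (R : realType) (V : lmodType R[i]) (dot : V -> V -> R[i]).
Local Notation Re := (@complex.Re R).
Local Notation Im := (@complex.Im R).

Record inner_product : Prop := InnerProduct {
  inner_linear : forall a x y z, dot (a *: x + y) z = a * dot x z + dot y z;
  inner_conj : forall x y, dot y x = (dot x y)^*;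
  inner_ge0 : forall x, 0 <= Re (dot x x);
  inner_eq0 : forall x, Re (dot x x) = 0 -> x = 0 }.

(** Orthogonality and adjointness are taken in this real sense; on a complex subspace [rdot] and
    [dot] have the same orthogonal complement. *)
Definition rdot (x y : V) : R := Re (dot x y).
Local Notation norm := (dot_norm dot).

Hypothesis ip : inner_product.

Lemma rdotC x y : rdot x y = rdot y x.
Proof. by rewrite /rdot (inner_conj ip); case: (dot _ _). Qed.

Lemma rdot_lin (a : R[i]) x y z :
  rdot (a *: x + y) z = Re a * rdot x z - Im a * Im (dot x z) + rdot y z.
Proof. by rewrite /rdot (inner_linear ip); case: a (dot x z) (dot y z) => [? ?] [? ?] []. Qed.

Lemma rdotDl x y z : rdot (x + y) z = rdot x z + rdot y z.
Proof. by rewrite -{1}[x]scale1r rdot_lin /= mul1r mul0r subr0. Qed.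

Lemma rdotDr x y z : rdot x (y + z) = rdot x y + rdot x z.
Proof. by rewrite rdotC rdotDl !(rdotC x). Qed.

Lemma rdot0l x : rdot 0 x = 0.
Proof. by have /eqP := rdotDl 0 0 x; rewrite addr0 -subr_eq subrr => /eqP. Qed.

Lemma rdot0r x : rdot x 0 = 0.
Proof. by rewrite rdotC rdot0l. Qed.

Lemma rdotNl x y : rdot (- x) y = - rdot x y.
Proof. by apply/eqP; rewrite -addr_eq0 -rdotDl addNr rdot0l. Qed.

Lemma rdotNr x y : rdot x (- y) = - rdot x y.
Proof. by rewrite rdotC rdotNl rdotC. Qed.

Lemma rdotZl (a : R) x y : rdot (a%:C *: x) y = a * rdot x y.
Proof. by have := rdot_lin a%:C x 0 y; rewrite addr0 rdot0l addr0 /= mul0r subr0. Qed.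

Lemma rdotZr (a : R) x y : rdot x (a%:C *: y) = a * rdot x y.
Proof. by rewrite rdotC rdotZl rdotC. Qed.

Lemma dotZl (k : R[i]) x y : dot (k *: x) y = k * dot x y.
Proof.
have d0 : dot 0 y = 0.
  have /eqP := inner_linear ip 1 0 0 y.
  by rewrite scaler0 addr0 mul1r -subr_eq subrr => /eqP.
by rewrite -[k *: x]addr0 (inner_linear ip) d0 addr0.
Qed.

Lemma rdot_adj (k : R[i]) x y : rdot (k *: x) y = rdot x (k^* *: y).
Proof.
rewrite [RHS]rdotC /rdot !dotZl (inner_conj ip x y).
by case: k (dot x y) => [a b] [c d] /=; ring.
Qed.

Lemma rdot_scale_self (k : R[i]) x : rdot (k *: x) x = Re k * rdot x x.
Proof.
rewrite /rdot dotZl; have := inner_conj ip x x.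
case: k (dot x x) => [a b] [c d] /= [/eqP].
by rewrite -addr_eq0 -mulr2n mulrn_eq0 /= => /eqP ->; rewrite mulr0 subr0.
Qed.

Lemma rdot_scale_scale (k : R[i]) x :
  rdot (k *: x) (k *: x) = (Re k ^+ 2 + Im k ^+ 2) * rdot x x.
Proof.
rewrite rdot_adj scalerA rdotC rdot_scale_self; congr (_ * _).
by case: k => a b /=; ring.
Qed.

Lemma rdot_ge0 x : 0 <= rdot x x.
Proof. exact: inner_ge0. Qed.

Lemma norm_ge0 x : 0 <= norm x.
Proof. exact: sqrtr_ge0. Qed.

Lemma norm_sqr x : norm x ^+ 2 = rdot x x.
Proof. by rewrite /dot_norm sqr_sqrtr// rdot_ge0. Qed.

Lemma norm_eq0 x : norm x = 0 -> x = 0.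
Proof. by move=> x0; apply: (inner_eq0 ip); rewrite -/(rdot x x) -norm_sqr x0 expr0n. Qed.

Lemma norm0 : norm 0 = 0.
Proof. by rewrite /dot_norm -/(rdot 0 0) rdot0l sqrtr0. Qed.

(** Cauchy-Schwarz, from the squared norm of x minus its component along y. *)
Lemma rdot_sqr_le x y : rdot x y ^+ 2 <= rdot x x * rdot y y.
Proof.
have [y0|yN0] := eqVneq (rdot y y) 0.
  by rewrite (inner_eq0 ip y0) !rdot0r expr0n mulr0.
have y0 : 0 < rdot y y by rewrite lt_def yN0 rdot_ge0.
have := rdot_ge0 (x + (- (rdot x y / rdot y y))%:C *: y).
rewrite rdotDl !rdotDr !rdotZl !rdotZr (rdotC y x).
set a := rdot x x; set b := rdot x y; set c := rdot y y in y0 yN0 *.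
rewrite (_ : _ + _ = (a * c - b ^+ 2) / c); last by field.
by rewrite pmulr_lge0 ?invr_gt0// subr_ge0.
Qed.

Lemma norm_rdot_le x y : `|rdot x y| <= norm x * norm y.
Proof.
rewrite -(@ler_pXn2r _ 2)// ?nnegrE ?mulr_ge0 ?norm_ge0//.
by rewrite exprMn !norm_sqr real_normK ?num_real// rdot_sqr_le.
Qed.

Lemma normD x y : norm (x + y) <= norm x + norm y.
Proof.
rewrite -(@ler_pXn2r _ 2)// ?nnegrE ?addr_ge0 ?norm_ge0//.
rewrite sqrrD !norm_sqr rdotDl !rdotDr (rdotC y x).
by have := le_trans (ler_norm _) (norm_rdot_le x y); lra.
Qed.

Lemma normZ (k : R[i]) x : norm (k *: x) = Normc.normc k * norm x.
Proof.
apply/eqP; rewrite -(@eqrXn2 _ 2)// ?mulr_ge0 ?norm_ge0//; last first.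
  by case: k => a b; exact: sqrtr_ge0.
rewrite exprMn !norm_sqr rdot_scale_scale; case: k => a b /=.
by rewrite sqr_sqrtr// addr_ge0 ?sqr_ge0.
Qed.

Lemma normN x : norm (- x) = norm x.
Proof. by rewrite /dot_norm -!/(rdot _ _) rdotNl rdotNr opprK. Qed.

Lemma normB x y : norm (x - y) = norm (y - x).
Proof. by rewrite -normN opprB. Qed.

Lemma normB_le x y : norm (x - y) <= norm x + norm y.
Proof. by rewrite -(normN y) normD. Qed.

Lemma dot_cvg_le (x_ : nat -> V) x (e_ : nat -> R) :
  (forall n, norm (x_ n - x) <= e_ n) -> e_ n @[n --> \oo] --> (0 : R) ->
  dot_cvg dot x_ x.
Proof.
move=> le e0; apply: squeeze_cvgr (cvg_cst 0) e0.
by near=> n; rewrite norm_ge0 le.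
Unshelve. all: by end_near. Qed.

Lemma dot_cvg_lin (k : R[i]) x_ y_ x y : dot_cvg dot x_ x -> dot_cvg dot y_ y ->
  dot_cvg dot (fun n => k *: x_ n + y_ n) (k *: x + y).
Proof.
move=> xx yy.
apply: (@dot_cvg_le _ _ (fun n => Normc.normc k * norm (x_ n - x) + norm (y_ n - y))).
  move=> n; rewrite -normZ (_ : _ - _ = k *: (x_ n - x) + (y_ n - y)) ?normD//.
  by rewrite scalerBr opprD addrACA.
rewrite -[0 in X in _ --> X](addr0 0) -[0 in X in _ --> X + _](mulr0 (Normc.normc k)).
by apply: cvgD => //; apply: cvgM => //; exact: cvg_cst.
Qed.

Lemma dot_cvgD x_ y_ x y : dot_cvg dot x_ x -> dot_cvg dot y_ y ->
  dot_cvg dot (fun n => x_ n + y_ n) (x + y).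
Proof.
by move=> xx /(dot_cvg_lin 1 xx); rewrite /dot_cvg; under eq_fun do rewrite !scale1r.
Qed.

Lemma rdot_cvg (x_ : nat -> V) x y : dot_cvg dot x_ x ->
  rdot (x_ n) y @[n --> \oo] --> rdot x y.
Proof.
move=> xx; apply/cvgrPdist_le => e e0.
have ny : 0 < norm y + 1 by rewrite ltr_wpDl ?norm_ge0.
move/cvgrPdist_le : xx => /(_ (e / (norm y + 1)) (divr_gt0 e0 ny)).
apply: filterS => n /=; rewrite sub0r normrN ger0_norm ?norm_ge0// => le.
rewrite -rdotNl -rdotDl (le_trans (norm_rdot_le _ _))// normB.
rewrite (le_trans (ler_wpM2r (norm_ge0 _) le))// mulrAC ler_pdivrMr//.
by rewrite ler_wpM2l ?(ltW e0)// lerDl.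
Qed.

Lemma dot_cvg_unique (x_ : nat -> V) x y :
  dot_cvg dot x_ x -> dot_cvg dot x_ y -> x = y.
Proof.
move=> /rdot_cvg xx /rdot_cvg xy; apply/subr0_eq/(inner_eq0 ip).
rewrite -/(rdot _ _) rdotDl rdotNl; apply/eqP; rewrite subr_eq0; apply/eqP.
exact: (cvg_unique _ (xx _) (xy _)).
Qed.

(** Completeness is stated for sequences with this geometric rate. Near-minimizers of a distance can
    be chosen with it, and solutions inherit it from their data. *)
Definition fast (x_ : nat -> V) :=
  exists C : R, forall n, norm (x_ n.+1 - x_ n) <= C / 4 ^+ n.

Hypothesis complete : forall x_, fast x_ -> exists x, dot_cvg dot x_ x.

(** Orthogonal projection: near-minimizers of the distance from x to W converge by the parallelogram
    law, and the residual at the limit is orthogonal to W, hence zero. *)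
Lemma closed_subspace_full (W : V -> Prop) : W 0 ->
  (forall (a : R) x y, W x -> W y -> W (a%:C *: x + y)) ->
  (forall x_ x, (forall n, W (x_ n)) -> fast x_ -> dot_cvg dot x_ x -> W x) ->
  (forall h, (forall w, W w -> rdot h w = 0) -> h = 0) -> forall x, W x.
Proof.
move=> W0 Wlin Wcl Worth x.
pose Q w := rdot (x - w) (x - w).
pose S := [set Q w | w in W].
have S0 : S !=set0 by exists (Q 0), 0.
have lbS : lbound S 0 by move=> _ [w _ <-]; exact: rdot_ge0.
have hS : has_inf S by split => //; exists 0.
pose d := inf S.
have dle w : W w -> d <= Q w by move=> Ww; apply: ge_inf; [exists 0|exists w].
(* With an excess of 16^-n, the parallelogram law bounds the squared increments by 4 / 16^n, that is
   the increments by 2 / 4^n. *)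
have /choice[w_ w_P] : forall n, exists w, W w /\ Q w <= d + (16 ^+ n)^-1.
  move=> n; have e0 : 0 < (16 ^+ n)^-1 :> R by rewrite invr_gt0 exprn_gt0.
  by have [_ [w Ww <-] /ltW] := inf_adherent e0 hS; exists w.
(* The midpoint of u and v lies in W; the added 0 gives it the shape required by [Wlin]. *)
have para u v : W u -> W v -> rdot (u - v) (u - v) <= 2 * (Q u + Q v) - 4 * d.
  move=> Wu Wv; have := dle ((2^-1)%:C *: u + ((2^-1)%:C *: v + 0)).
  have Wuv : W ((2^-1)%:C *: u + ((2^-1)%:C *: v + 0)) by do 2 apply: (Wlin _ _ _) => //.
  move=> /(_ Wuv); rewrite addr0 /Q.
  rewrite !(rdotDl, rdotDr, rdotNl, rdotNr, rdotZl, rdotZr) !(rdotC v) !(rdotC u x).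
  by lra.
have fw : fast w_.
  exists 2 => n; rewrite -(@ler_pXn2r _ 2)// ?nnegrE ?norm_ge0//.
  have [Wn Qn] := w_P n; have [Wn1 Qn1] := w_P n.+1.
  rewrite norm_sqr (le_trans (para _ _ Wn1 Wn))// expr_div_n -exprM mulnC exprM.
  have {Qn1} : Q (w_ n.+1) <= d + (16 ^+ n)^-1.
    rewrite (le_trans Qn1)// lerD2l lef_pV2 ?posrE ?exprn_gt0//.
    by rewrite exprS ler_peMl ?exprn_ge0 ?ler1n.
  move: Qn; rewrite (_ : 4 ^+ 2 = 16 :> R); last by ring.
  by rewrite (_ : 2 ^+ 2 = 4 :> R); [lra|ring].
have [w ww] := complete fw.
have Ww : W w by apply: Wcl fw ww => n; have [] := w_P n.
have d0 : 0 <= d by apply: lb_le_inf.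
have Qw : Q w <= d.
  suff le : norm (x - w) <= Num.sqrt d.
    by rewrite /Q -norm_sqr -[d]sqr_sqrtr// ler_pXn2r// nnegrE ?norm_ge0 ?sqrtr_ge0.
  have c2 : Num.sqrt d + (4 ^+ n)^-1 + norm (w_ n - w) @[n --> \oo] --> Num.sqrt d + 0 + 0.
    apply: cvgD => //; apply: cvgD; first exact: cvg_cst.
    under eq_fun do rewrite -exprVn.
    by apply: cvg_expr; rewrite gtr0_norm ?invr_gt0// invf_lt1 ?ltr1n.
  rewrite -[Num.sqrt d]addr0 -[_ + 0]addr0; apply: ler_cvg_to (cvg_cst _) c2 _.
  near=> n; have [_ Qn] := w_P n.
  rewrite -(subrKA (w_ n)) (le_trans (normD _ _))// lerD2r.
  have e0 : 0 <= (4 ^+ n)^-1 :> R by rewrite invr_ge0 exprn_ge0.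
  rewrite -(@ler_pXn2r _ 2)// ?nnegrE ?norm_ge0 ?addr_ge0 ?sqrtr_ge0//.
  rewrite norm_sqr (le_trans Qn)// sqrrD sqr_sqrtr// exprVn -exprM mulnC exprM.
  rewrite (_ : 4 ^+ 2 = 16 :> R); last by ring.
  by rewrite lerD2r lerDl mulrn_wge0// mulr_ge0 ?sqrtr_ge0.
suff -> : x = w by [].
apply/subr0_eq/Worth => y Wy.
(* Moving w by s y inside W cannot reduce the distance to x. Taking s = <x - w, y> / <y, y>, the
   minimizer of this quadratic, then forces <x - w, y> = 0. *)
have key (s : R) : 0 <= s ^+ 2 * rdot y y - 2 * s * rdot (x - w) y.
  have := dle (s%:C *: y + w) (Wlin _ _ _ Wy Ww).
  rewrite /Q (_ : x - (s%:C *: y + w) = (x - w) - s%:C *: y); last first.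
    by rewrite opprD addrCA addrC.
  move: Qw; rewrite /Q; move: (x - w) => z.
  rewrite !(rdotDl, rdotDr, rdotNl, rdotNr, rdotZl, rdotZr) (rdotC y z).
  by lra.
have [y0|yN0] := eqVneq (rdot y y) 0; first by rewrite (inner_eq0 ip y0) rdot0r.
have y0 : 0 < rdot y y by rewrite lt_def yN0 rdot_ge0.
have := key (rdot (x - w) y / rdot y y); set a := rdot _ y; set b := rdot y y in y0 yN0 *.
rewrite (_ : _ - _ = - (a ^+ 2 / b)); last by field.
rewrite oppr_ge0 pmulr_lle0 ?invr_gt0// => a0.
by apply/eqP; rewrite -sqrf_eq0 eq_le a0 sqr_ge0.
Unshelve. all: by end_near. Qed.

(** With S read as the graph of an operator, this is the graph of minus its adjoint; S is
    skew-symmetric exactly when it is contained in [adj S]. *)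
Definition adj (S : V -> V -> Prop) (f f' : V) : Prop :=
  forall g g', S g g' -> rdot f g' + rdot f' g = 0.

Lemma adj_lin S (a : R) f f' g g' : adj S f f' -> adj S g g' ->
  adj S (a%:C *: f + g) (a%:C *: f' + g').
Proof.
move=> ff' gg' h h' hh'; rewrite !rdotDl !rdotZl.
by have := ff' _ _ hh'; have := gg' _ _ hh'; nra.
Qed.

Lemma adj_closed S f_ f'_ f f' : (forall n, adj S (f_ n) (f'_ n)) ->
  dot_cvg dot f_ f -> dot_cvg dot f'_ f' -> adj S f f'.
Proof.
move=> adjS ff ff' g g' gg'.
have c0 : rdot (f_ n) g' + rdot (f'_ n) g @[n --> \oo] --> (0 : R).
  by under eq_fun do rewrite (adjS _ _ _ gg'); exact: cvg_cst.
apply: (cvg_unique _ _ c0) => //.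
exact: cvgD (@rdot_cvg _ _ g' ff) (@rdot_cvg _ _ g ff').
Qed.

(** Pairing f' + k f with f leaves Re k times the squared norm of f, and Cauchy-Schwarz concludes.
    Both the closed range and the bound on the inverse come from this estimate. *)
Lemma skew_lower_bound (k : R[i]) f f' : rdot f' f = 0 ->
  `|Re k| * norm f <= norm (f' + k *: f).
Proof.
move=> skew; have [->|f0] := eqVneq f 0; first by rewrite norm0 mulr0 norm_ge0.
have nf : 0 < norm f.
  by rewrite lt_def norm_ge0 andbT; apply: contra_neq f0; exact: norm_eq0.
rewrite -(ler_pM2r nf) (le_trans _ (norm_rdot_le _ _))//.
rewrite rdotDl skew add0r rdot_scale_self -norm_sqr normrM.
by rewrite (ger0_norm (sqr_ge0 _)) mulrA.
Qed.

(** By the lower bound, a fast sequence of values f' + k f comes from a fast sequence of f, so the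
    range is closed because [adj S] is; its orthogonal complement being trivial, it is the whole
    space. *)
Lemma adj_range S (k : R[i]) : Re k != 0 ->
  (forall f f', adj S f f' -> rdot f' f = 0) ->
  (forall h, (forall f f', adj S f f' -> rdot h (f' + k *: f) = 0) -> h = 0) ->
  forall h, exists f f', adj S f f' /\ f' + k *: f = h.
Proof.
move=> k0 skew ker; have k_gt0 : 0 < `|Re k| by rewrite normr_gt0.
apply: closed_subspace_full.
- exists 0, 0; split; last by rewrite scaler0 addr0.
  by move=> g g' _; rewrite !rdot0l addr0.
- move=> a _ _ [f [f' [ff' <-]]] [g [g' [gg' <-]]].
  exists (a%:C *: f + g), (a%:C *: f' + g'); split; first exact: adj_lin.
  by rewrite !scalerDr !scalerA (mulrC k) addrACA.
- move=> h_ h /choice[f_ /choice[f'_ ff]] fh hh.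
  have fastf : fast f_.
    case: fh => C hC; exists (`|Re k|^-1 * C) => n.
    rewrite -mulrA mulrC ler_pdivlMr// mulrC (le_trans _ (hC n))//.
    have [adj1 <-] := ff n.+1; have [adj0 <-] := ff n.
    rewrite (_ : f'_ n.+1 + _ - _ = (f'_ n.+1 - f'_ n) + k *: (f_ n.+1 - f_ n)).
      apply/skew_lower_bound/skew.
      have := adj_lin (-1) adj0 adj1.
      by rewrite rmorphN1 !scaleN1r ![- _ + _]addrC.
    by rewrite scalerBr addrACA opprD.
  have [f ff_] := complete fastf.
  have ff'_ : dot_cvg dot f'_ ((- k) *: f + h).
    suff -> : f'_ = fun n => (- k) *: f_ n + h_ n by exact: dot_cvg_lin.
    by apply/funext => n; have [_ <-] := ff n; rewrite scaleNr addrCA addNr addr0.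
  exists f, (- k *: f + h); split; last by rewrite scaleNr addrAC addNr add0r.
  by apply: adj_closed ff_ ff'_ => n; have [] := ff n.
- by move=> h hW; apply: ker => f f' ff'; apply: hW; exists f, f'.
Qed.

(* The closure of [T] is [adj (adj T)]: being skew-symmetric with no deficiency
   at +1 and -1, it has no proper skew extension inside [adj T]. *)
Lemma adj_skew (T : V -> V -> Prop) : (forall f f', T f f' -> adj T f f') ->
  (forall f, adj T f f -> f = 0) -> (forall f, adj T f (- f) -> f = 0) ->
  forall f f', adj T f f' -> adj (adj T) f f'.
Proof.
move=> TT K1 K2 f f' ff'; set D := adj T.
have DT g g' : adj D g g' -> D g g' by move=> gg' h h' /TT; exact: gg'.
have [g [g' [gg' eq]]] : exists g g', adj D g g' /\ g' + 1 *: g = f' + 1 *: f.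
  apply: adj_range; first exact: oner_neq0.
    move=> g g' gg'; have := gg' _ _ (DT _ _ gg').
    by rewrite (rdotC g g'); lra.
  (* T is contained in [adj D], so orthogonality to the range over [adj D] yields in particular
     [adj T h h]. *)
  move=> h hD; apply: K1 => g g' Tgg'.
  have /hD : adj D g g' by move=> u u' /(_ _ _ Tgg'); rewrite (rdotC u) (rdotC u'); lra.
  by rewrite scale1r rdotDr.
have fg : f = g; last first.
  by move: eq; rewrite fg => /addIr <-.
(* f - g lies in the domain of [adj T] and is mapped to -(f - g), which K2 excludes unless f = g. *)
apply/subr0_eq/K2; have := adj_lin (-1) (DT _ _ gg') ff'.
rewrite rmorphN1 !scaleN1r ![- _ + _]addrC.
suff -> : f' - g' = - (f - g) by [].
apply/eqP; rewrite opprB subr_eq addrAC -subr_eq opprK.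
by move: eq; rewrite !scale1r addrC (addrC _ f) => ->.
Qed.

End InnerProduct.

(** * Completeness of real L^2 along geometrically convergent sequences *)

Section RealL2.
Variable R : realType.
Local Notation mu := (@lebesgue_measure R).
Local Notation Lfun2 := (Lfun mu 2%:E).

Lemma Lfun2P (f : R -> R) : f \in Lfun2 <->
  measurable_fun setT f /\ (\int[mu]_x (f x ^+ 2)%:E < +oo)%E.
Proof.
have sqE : (\int[mu]_x (f x ^+ 2)%:E = \int[mu]_x (`|f x| `^ 2)%:E)%E.
  by apply: eq_integral => x _; rewrite powR_mulrn// real_normK ?num_real.
split=> [fL|[mf fL]].
- have := fL; rewrite inE => /andP[]; rewrite inE /= => mf _; split => //.
  have /integrableP[_] := Lfun2_integrable_sqr fL; apply: le_lt_trans.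
  by rewrite le_eqVlt; apply/orP; left; apply/eqP/eq_integral => x _ /=; rewrite ger0_norm ?sqr_ge0.
- rewrite inE; apply/andP; split; rewrite inE//=.
  rewrite /finite_norm unlock poweR_lty//=; apply: le_lt_trans fL.
  by rewrite sqE.
Qed.

Lemma Lfun2B (f g : R -> R) : f \in Lfun2 -> g \in Lfun2 ->
  (fun x => f x - g x) \in Lfun2.
Proof.
move=> fL gL; have := Lfun2_comb 1 (-1) fL gL.
by under eq_fun do rewrite mul1r mulN1r.
Qed.

(** With s = sqrt M, the increments from n on sum to at most 2 s / 2^n, which gives both the limit
    and the rate. *)
Lemma geometric_increments_cvg (a : nat -> R) (M : R) : 0 <= M ->
  (forall n, 4 ^+ n * (a n.+1 - a n) ^+ 2 <= M) ->
  exists2 l, a n @[n --> \oo] --> l & forall n, (a n - l) ^+ 2 <= 4 * M / 4 ^+ n.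
Proof.
move=> M0 aM; pose s := Num.sqrt M.
have s0 : 0 <= s by exact: sqrtr_ge0.
have sE : s ^+ 2 = M by rewrite sqr_sqrtr.
have pE n : (2 ^+ n) ^+ 2 = 4 ^+ n :> R by rewrite -exprM mulnC exprM; congr (_ ^+ _); ring.
have p0 n : 0 < 2 ^+ n :> R by rewrite exprn_gt0.
have d n : `|a n.+1 - a n| <= s / 2 ^+ n.
  rewrite -(@ler_pXn2r _ 2)// ?nnegrE ?divr_ge0 ?(ltW (p0 _))//.
  rewrite real_normK ?num_real// expr_div_n sE pE ler_pdivlMr ?exprn_gt0//.
  by rewrite mulrC.
(* Adding or subtracting the geometric tail makes the sequence monotone, and the limit is caught
   between the two. *)
pose b n := a n + 2 * (s / 2 ^+ n); pose c n := a n - 2 * (s / 2 ^+ n).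
have half n : s / 2 ^+ n.+1 = 2^-1 * (s / 2 ^+ n).
  by rewrite exprS invfM mulrCA.
have bdec n : b n.+1 <= b n.
  by have := d n; rewrite ler_norml => /andP[_]; rewrite /b half; lra.
have cinc n : c n <= c n.+1.
  by have := d n; rewrite ler_norml => /andP[+ _]; rewrite /c half; lra.
have {}bdec : nonincreasing_seq b by apply/nonincreasing_seqP.
have {}cinc : nondecreasing_seq c by apply/nondecreasing_seqP.
have e0 n : 0 <= 2 * (s / 2 ^+ n) by rewrite mulr_ge0// divr_ge0// ltW.
have cb n : c n <= b 0%N by rewrite (le_trans _ (bdec _ _ (leq0n n)))// lerD2l ge0_cp.
have cc : cvgn c by apply: nondecreasing_is_cvgn => //; exists (b 0%N) => _ [n _ <-].
have e_cvg : 2 * (s / 2 ^+ n) @[n --> \oo] --> (0 : R).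
  rewrite -(mulr0 2); apply: cvgM; first exact: cvg_cst.
  rewrite -(mulr0 s); apply: cvgM; first exact: cvg_cst.
  under eq_fun do rewrite -exprVn.
  by apply: cvg_expr; rewrite gtr0_norm ?invr_gt0// invf_lt1 ?ltr1n.
have a_cvg : a n @[n --> \oo] --> limn c.
  rewrite -[limn c]addr0; have -> : a = fun n => c n + 2 * (s / 2 ^+ n).
    by apply/funext => n; rewrite subrK.
  exact: cvgD.
have b_cvg : b n @[n --> \oo] --> limn c.
  by rewrite -[limn c]addr0; exact: cvgD.
exists (limn c) => // n.
have cl : c n <= limn c by exact: nondecreasing_cvgn_le.
have bl : limn c <= b n.
  rewrite -(cvg_lim _ b_cvg)//; apply: nonincreasing_cvgn_ge => //.
  by apply/cvg_ex; exists (limn c).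
have {cl bl} : `|a n - limn c| <= 2 * (s / 2 ^+ n).
  by rewrite ler_norml; move: cl bl; rewrite /c /b => ? ?; apply/andP; split; lra.
rewrite -(@ler_pXn2r _ 2)// ?nnegrE// real_normK ?num_real// => /le_trans; apply.
rewrite exprMn expr_div_n sE pE mulrA ler_wpM2r ?invr_ge0 ?exprn_ge0//.
by rewrite (_ : 2 ^+ 2 = 4)//; ring.
Qed.

(** Riesz-Fischer with a rate: G = sum of 4^n (f_(n+1) - f_n)^2 has a finite integral, so almost
    everywhere G is finite and (f_n - f)^2 <= 4 G / 4^n. Integrating this bound gives the
    convergence. *)
Lemma Lfun2_fast_complete (f_ : nat -> R -> R) (C : R) : 
  (forall n, f_ n \in Lfun2) ->
  (forall n, (\int[mu]_x ((f_ n.+1 x - f_ n x) ^+ 2)%:E <= (C / 16 ^+ n)%:E)%E) ->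
  exists2 f, f \in Lfun2 &
    (\int[mu]_x ((f_ n x - f x) ^+ 2)%:E)%E @[n --> \oo] --> (0 : \bar R)%E.
Proof.
move=> fL fC.
have mf n : measurable_fun setT (f_ n) by case: (Lfun2P (f_ n)).1.
have C0 : 0 <= C.
  have := fC 0%N; rewrite expr0 divr1 -lee_fin; apply: le_trans.
  by apply: integral_ge0 => x _; rewrite lee_fin sqr_ge0.
pose d n x := (4 ^+ n * (f_ n.+1 x - f_ n x) ^+ 2)%:E.
have d0 n x : (0 <= d n x)%E by rewrite lee_fin mulr_ge0 ?sqr_ge0 ?exprn_ge0.
have md2 n : measurable_fun setT (fun x => (f_ n.+1 x - f_ n x) ^+ 2).
  by apply: measurable_funX; exact: measurable_funB.
have md n : measurable_fun setT (d n).
  by apply/measurable_EFinP; apply: measurable_funM => //; exact: measurable_cst.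
pose G x := (\sum_(n <oo) d n x)%E.
have mG : measurable_fun setT G.
  by apply: ge0_emeasurable_sum.
have G0 x : (0 <= G x)%E by exact: nneseries_ge0.
(* The weight turns C / 16^n into C / 4^n, whose sum 4 C / 3 is rounded up to 2 C. *)
have Gfin : (\int[mu]_x G x <= (2 * C)%:E)%E.
  rewrite integral_nneseries//.
  apply: lime_le; first by apply: is_cvg_nneseries => n _ _; exact: integral_ge0.
  near=> N; apply: (@le_trans _ _ (\sum_(0 <= n < N) (C / 4 ^+ n)%:E)%E).
    apply: lee_sum => n _; rewrite /d; under eq_integral do rewrite EFinM.
    have -> : (\int[mu]_x ((4 ^+ n)%:E * ((f_ n.+1 x - f_ n x) ^+ 2)%:E) =
        (4 ^+ n)%:E * \int[mu]_x ((f_ n.+1 x - f_ n x) ^+ 2)%:E)%E.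
      apply: ge0_integralZl_EFin => //.
      - by move=> x _; rewrite lee_fin sqr_ge0.
      - by have := md2 n; move/measurable_EFinP.
    rewrite (le_trans (lee_wpmul2l _ (fC n)))// ?lee_fin ?exprn_ge0//.
    rewrite (_ : 16 ^+ n = 4 ^+ n * 4 ^+ n).
      by rewrite invfM mulrCA mulVKf ?expf_neq0.
    by rewrite -exprMn; congr (_ ^+ _); ring.
  rewrite sumEFin lee_fin.
  have := @geometric_le_lim R N C 4^-1 C0; rewrite invr_gt0 ltr0n => /(_ isT).
  rewrite gtr0_norm ?invr_gt0// invf_lt1// ltr1n => /(_ isT).
  rewrite /series /=; under eq_bigr do rewrite exprVn.
  by move=> /le_trans; apply; rewrite (_ : (1 - 4^-1)^-1 = 4 / 3); [lra|field].
have iG : mu.-integrable setT G.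
  apply/integrableP; split => //; under eq_integral do rewrite gee0_abs//.
  by rewrite (le_lt_trans Gfin)// ltry.
have [N [mN muN0 GN]] := integrable_ae measurableT iG.
have pw x : ~ N x -> exists2 l, f_ n x @[n --> \oo] --> l &
    forall n, (((f_ n x - l) ^+ 2)%:E <= (4 / 4 ^+ n)%:E * G x)%E.
  move=> Nx; have Gx : G x \is a fin_num.
    by move: Nx; apply: contra_notT => Gx; apply: GN => /(_ I); exact/negP.
  have [|n|l ? le] := @geometric_increments_cvg (f_ ^~ x) (fine (G x)).
  - by rewrite fine_ge0.
  - rewrite -lee_fin fineK// (le_trans _ (@nneseries_lim_ge _ (d ^~ x) xpredT 0%N n.+1 _))//.
    by rewrite big_nat_recr//= leeDr// sume_ge0.
  exists l => // n; rewrite -(fineK Gx) -EFinM lee_fin (le_trans (le n))//.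
  by rewrite mulrAC.
(* With the value 0 on the null set N, f is the limit at every point of the f_n restricted to the
   complement of N, hence measurable. *)
pose f x := if x \in N then 0 else limn (f_ ^~ x).
have fE x : ~ N x -> f_ n x @[n --> \oo] --> f x /\
    forall n, (((f_ n x - f x) ^+ 2)%:E <= (4 / 4 ^+ n)%:E * G x)%E.
  move=> Nx; have [l fl le] := pw x Nx.
  by rewrite /f memNset// (cvg_lim _ fl).
have mf_ : measurable_fun setT f.
  apply: (@measurable_fun_cvg _ _ _ _ (fun n => f_ n \_ (~` N))).
    by move=> n; apply/(measurable_restrictT _ _).1; [exact: measurableC|exact: measurable_funS (mf n)].
  move=> x _; have [Nx|Nx] := pselect (N x).
    have xN : x \in ~` N = false by rewrite memNset// => /(_ Nx).
    by rewrite /f mem_set//; under eq_fun do rewrite patchE xN; exact: cvg_cst.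
  under eq_fun do rewrite patchE mem_set//.
  exact: (fE x Nx).1.
have msq n : measurable_fun setT (fun x => ((f_ n x - f x) ^+ 2)%:E).
  by apply/measurable_EFinP; apply: measurable_funX; exact: measurable_funB.
have bd n : (\int[mu]_x ((f_ n x - f x) ^+ 2)%:E <= (8 * C / 4 ^+ n)%:E)%E.
  apply: (@le_trans _ _ (\int[mu]_x ((4 / 4 ^+ n)%:E * G x))%E).
    apply: ae_ge0_le_integral => //.
    - by move=> x _; rewrite lee_fin sqr_ge0.
    - exact: msq.
    - by move=> x _; rewrite mule_ge0// lee_fin divr_ge0// exprn_ge0.
    - by apply: emeasurable_funM => //; exact: measurable_cst.
    by exists N; split => // x /= xN; apply: contrapT => Nx; apply: xN => _; exact: (fE x Nx).2.
  have c0 : 0 <= 4 / 4 ^+ n :> R by rewrite divr_ge0// exprn_ge0.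
  have -> : (\int[mu]_x ((4 / 4 ^+ n)%:E * G x) =
      (4 / 4 ^+ n)%:E * \int[mu]_x G x)%E by exact: ge0_integralZl_EFin.
  rewrite (le_trans (lee_wpmul2l _ Gfin))//.
  by rewrite -EFinM lee_fin mulrAC mulrA -natrM.
exists f.
  have -> : f = fun x => f_ 0%N x - (f_ 0%N x - f x).
    by apply/funext => x; rewrite opprB addrC subrK.
  apply: Lfun2B => //; apply/Lfun2P; split; first exact: measurable_funB.
  by rewrite (le_lt_trans (bd 0%N))// ltry.
apply: (@squeeze_cvge _ _ _ _ (cst 0%E) _ (fun n => (8 * C / 4 ^+ n)%:E)).
- by near=> n; rewrite bd andbT; apply: integral_ge0 => x _; rewrite lee_fin sqr_ge0.
- exact: cvg_cst.
- apply: cvg_EFin; first by near=> n.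
  rewrite -(mulr0 (8 * C)); apply: cvgM; first exact: cvg_cst.
  under [X in X @ _]eq_fun do rewrite /= -exprVn.
  by apply: cvg_expr; rewrite gtr0_norm ?invr_gt0// invf_lt1 ?ltr1n.
Unshelve. all: by end_near. Qed.

End RealL2.

(** * L^2(R; C) as a complete inner product space *)

Section ComplexL2Space.
Variable R : realType.
Local Notation mu := (@lebesgue_measure R).
Local Notation Lfun2 := (Lfun mu 2%:E).
Local Notation Re := (@complex.Re R).
Local Notation Im := (@complex.Im R).
Local Notation L2 := (L2 R).

Lemma L2_ext (f g : L2) : {ae mu, forall x, f x = g x} -> f = g.
Proof.
move=> fg; rewrite -[f]reprK -[g]reprK; apply/eqP.
rewrite -Quotient.idealrBE; apply/asboolP.
have FF := ae_filter_ringOfSetsType mu.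
apply: filterS fg => x fgx.
have -> : (repr f - repr g) x = f x - g x by [].
by rewrite fgx subrr.
Qed.

Lemma L2fun0 : {ae mu, forall x, (0 : L2) x = 0}.
Proof.
have FF := ae_filter_ringOfSetsType mu.
apply: filterS (L2fun_lin (-1) (0 : L2) 0) => x.
by rewrite scaler0 addr0 mulN1r addNr.
Qed.

Definition toL2 (f : R -> R[i]) (fL : f \in @sqint_pred R) : L2 :=
  \pi_L2 (Sqint fL).

Lemma toL2E f (fL : f \in @sqint_pred R) : {ae mu, forall x, toL2 fL x = f x}.
Proof.
have : repr (toL2 fL) = Sqint fL %[mod L2] by rewrite reprK.
move/eqP; rewrite -Quotient.idealrBE => /asboolP.
have FF := ae_filter_ringOfSetsType mu.
apply: filterS => x fgx.
have /eqP : repr (toL2 fL) x - f x = 0 := fgx.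
by rewrite subr_eq0 => /eqP.
Qed.

Lemma conj_sqint (f : R -> R[i]) : f \in @sqint_pred R ->
  (fun x => (f x)^*) \in @sqint_pred R.
Proof.
move=> /andP[fr fi]; apply/andP; split.
  have -> : Re \o (fun x => (f x)^*) = Re \o f by apply/funext => x /=; case: (f x).
  by [].
have -> : Im \o (fun x => (f x)^*) = fun x => -1 * (Im \o f) x + 0 * (Re \o f) x.
  by apply/funext => x /=; rewrite mul0r addr0 mulN1r; case: (f x).
exact: Lfun2_comb.
Qed.

Lemma Re_L2 (f : L2) : Re \o f \in Lfun2.
Proof. by have /andP[] := L2fun_sqint f. Qed.

Lemma Im_L2 (f : L2) : Im \o f \in Lfun2.
Proof. by have /andP[] := L2fun_sqint f. Qed.

Lemma Lfun2_mul_integrable (f g : R -> R) : f \in Lfun2 -> g \in Lfun2 ->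
  mu.-integrable setT (EFin \o (fun x => f x * g x)).
Proof. by move=> fL gL; apply/Lfun1_integrable; exact: Lfun2_mul_Lfun1. Qed.

Lemma rdotL2E (f g : L2) : rdot (@dotL2 R) f g =
  (\int[mu]_x (Re (f x) * Re (g x)) + \int[mu]_x (Im (f x) * Im (g x)))%R.
Proof.
have [_] := Rintegral_lin 1 1 (Lfun2_mul_integrable (Re_L2 f) (Re_L2 g))
  (Lfun2_mul_integrable (Im_L2 f) (Im_L2 g)).
rewrite !mul1r => <-; rewrite /rdot /dotL2 /=; apply: eq_Rintegral => x _.
by rewrite !mul1r /=; case: (f x) (g x) => [a b] [c d] /=; ring.
Qed.

(** The extended-real form lets definiteness and completeness be read off from integrals of
    nonnegative functions. *)
Lemma sqr_norm_L2 (f : L2) : ((rdot (@dotL2 R) f f)%:E =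
  \int[mu]_x (Re (f x) ^+ 2)%:E + \int[mu]_x (Im (f x) ^+ 2)%:E)%E.
Proof.
by rewrite rdotL2E EFinD; congr (_ + _)%E; rewrite /Rintegral fineK//;
  apply: integrable_fin_num => //; apply: Lfun2_mul_integrable;
  exact: Re_L2 || exact: Im_L2.
Qed.

Lemma dotL2_inner : inner_product (@dotL2 R).
Proof.
split.
- move=> a f g h; apply: cintegral_L2_lin; exact/conj_sqint/L2fun_sqint.
- move=> f g; rewrite /dotL2 /cintegral /=; apply/eqP; rewrite eq_complex /=.
  apply/andP; split; apply/eqP.
    by apply: eq_Rintegral => x _; case: (L2fun f x) (L2fun g x) => [a b] [c d] /=; ring.
  have [_ ifg] := sqint_mul (L2fun_sqint f) (conj_sqint (L2fun_sqint g)).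
  rewrite -mulN1r -RintegralZl//.
  by apply: eq_Rintegral => x _; case: (L2fun f x) (L2fun g x) => [a b] [c d] /=; ring.
- move=> f; rewrite -/(rdot _ f f) -lee_fin sqr_norm_L2.
  by apply: adde_ge0; apply: integral_ge0 => x _; rewrite lee_fin sqr_ge0.
- move=> f f0; apply: L2_ext.
  have : ((rdot (@dotL2 R) f f)%:E = 0)%E by rewrite /rdot f0.
  rewrite sqr_norm_L2 => /eqP.
  have i0 (h : R -> R) : (0 <= \int[mu]_x ((h x) ^+ 2)%:E)%E.
    by apply: integral_ge0 => x _; rewrite lee_fin sqr_ge0.
  rewrite padde_eq0// => /andP[/eqP r0 /eqP j0].
  have ae0 (h : R -> R) : h \in Lfun2 -> (\int[mu]_x ((h x) ^+ 2)%:E = 0)%E ->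
      {ae mu, forall x, h x = 0}.
    move=> /Lfun2P[mh _] h0.
    have mh2 : measurable_fun setT (fun x => h x ^+ 2) by exact: measurable_funX.
    have : ae_eq mu setT (fun x => (h x ^+ 2)%:E) (cst 0%E).
      apply/(ae_eq_integral_abs _ measurableT); first by move/measurable_EFinP : mh2.
      by rewrite -h0; apply: eq_integral => x _; rewrite gee0_abs// lee_fin sqr_ge0.
    have FF := ae_filter_ringOfSetsType mu.
    by apply: filterS => x /= /(_ I) [] /eqP; rewrite sqrf_eq0 => /eqP.
  have FF := ae_filter_ringOfSetsType mu.
  move: (ae0 _ (Re_L2 f) r0) (ae0 _ (Im_L2 f) j0) L2fun0; apply: filterS3 => x /= r1 j1 ->.
  by apply/eqP; rewrite eq_complex /= r1 j1 !eqxx.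
Qed.

Lemma toL2_comb (f : L2) g (gL : g \in @sqint_pred R) :
  {ae mu, forall x, (f - toL2 gL : L2) x = f x - g x}.
Proof.
have FF := ae_filter_ringOfSetsType mu.
move: (L2fun_lin (-1) (toL2 gL) f) (toL2E gL); apply: filterS2 => x.
by rewrite scaleN1r mulN1r addrC => -> ->; rewrite addrC.
Qed.

Lemma L2B (f g : L2) : {ae mu, forall x, (f - g : L2) x = f x - g x}.
Proof.
have FF := ae_filter_ringOfSetsType mu.
move: (L2fun_lin (-1) g f); apply: filterS => x.
by rewrite scaleN1r mulN1r addrC => ->; rewrite addrC.
Qed.

Lemma ae_sqr_norm_L2 (f : L2) (g : R -> R[i]) :
  measurable_fun setT (Re \o g) -> measurable_fun setT (Im \o g) ->
  {ae mu, forall x, f x = g x} -> ((rdot (@dotL2 R) f f)%:E =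
  \int[mu]_x (Re (g x) ^+ 2)%:E + \int[mu]_x (Im (g x) ^+ 2)%:E)%E.
Proof.
move=> mr mi fg; rewrite sqr_norm_L2.
have FF := ae_filter_ringOfSetsType mu.
have [mfr _] := (Lfun2P _).1 (Re_L2 f).
have [mfi _] := (Lfun2P _).1 (Im_L2 f).
have me (h : R -> R) : measurable_fun setT h ->
    measurable_fun setT (fun x => (h x ^+ 2)%:E).
  by move=> mh; apply/measurable_EFinP; exact: measurable_funX.
by congr (_ + _)%E; apply: ae_eq_integral => //; try (by apply: filterS fg => x /= ->);
  exact: me.
Qed.

(** Real and imaginary parts converge separately: the squared norm of an increment dominates both,
    and squaring the rate 4^-n gives the 16^-n of the real case. *)
Lemma L2_complete (f_ : nat -> L2) : fast (@dotL2 R) f_ ->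
  exists f, dot_cvg (@dotL2 R) f_ f.
Proof.
move=> [C fC].
have mRe (f : L2) : measurable_fun setT (Re \o f) by case: ((Lfun2P _).1 (Re_L2 f)).
have mIm (f : L2) : measurable_fun setT (Im \o f) by case: ((Lfun2P _).1 (Im_L2 f)).
have ReB (z w : R[i]) : Re (z - w) = Re z - Re w by case: z w => [? ?] [? ?].
have ImB (z w : R[i]) : Im (z - w) = Im z - Im w by case: z w => [? ?] [? ?].
have sqC n : ((rdot (@dotL2 R) (f_ n.+1 - f_ n) (f_ n.+1 - f_ n))%:E <= (C ^+ 2 / 16 ^+ n)%:E)%E.
  rewrite lee_fin -(norm_sqr dotL2_inner).
  have C0 : 0 <= C / 4 ^+ n by apply: le_trans (fC n); exact: norm_ge0.
  have := lerXn2r 2 (norm_ge0 _ _) C0 (fC n).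
  move=> /le_trans; apply; rewrite expr_div_n -exprM mulnC exprM.
  by rewrite (_ : 4 ^+ 2 = 16)//; ring.
have sqE n : ((rdot (@dotL2 R) (f_ n.+1 - f_ n) (f_ n.+1 - f_ n))%:E =
    \int[mu]_x ((Re (f_ n.+1 x) - Re (f_ n x)) ^+ 2)%:E +
    \int[mu]_x ((Im (f_ n.+1 x) - Im (f_ n x)) ^+ 2)%:E)%E.
  rewrite (@ae_sqr_norm_L2 _ (fun x => f_ n.+1 x - f_ n x)); last exact: L2B.
  - by congr (_ + _)%E; apply: eq_integral => x _; rewrite ?ReB ?ImB.
  - rewrite (_ : _ \o _ = fun x => Re (f_ n.+1 x) - Re (f_ n x)); last by apply/funext => x; rewrite /= ReB.
    exact: (measurable_funB (mRe (f_ n.+1)) (mRe (f_ n))).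
  - rewrite (_ : _ \o _ = fun x => Im (f_ n.+1 x) - Im (f_ n x)); last by apply/funext => x; rewrite /= ImB.
    exact: (measurable_funB (mIm (f_ n.+1)) (mIm (f_ n))).
have i0 (h : R -> R) : (0 <= \int[mu]_x ((h x) ^+ 2)%:E)%E.
  by apply: integral_ge0 => x _; rewrite lee_fin sqr_ge0.
have [r rL rc] : exists2 r, r \in Lfun2 &
    (\int[mu]_x ((Re (f_ n x) - r x) ^+ 2)%:E)%E @[n --> \oo] --> (0 : \bar R)%E.
  apply: (@Lfun2_fast_complete _ (fun n => Re \o f_ n) (C ^+ 2)); first by move=> n; exact: Re_L2.
  by move=> n; apply: le_trans (sqC n); rewrite sqE leeDl.
have [j jL jc] : exists2 j, j \in Lfun2 &
    (\int[mu]_x ((Im (f_ n x) - j x) ^+ 2)%:E)%E @[n --> \oo] --> (0 : \bar R)%E.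
  apply: (@Lfun2_fast_complete _ (fun n => Im \o f_ n) (C ^+ 2)); first by move=> n; exact: Im_L2.
  by move=> n; apply: le_trans (sqC n); rewrite sqE leeDr.
have gL : (fun x => r x +i* j x) \in @sqint_pred R by apply/andP; split.
exists (toL2 gL).
have [mr _] := (Lfun2P _).1 rL; have [mj _] := (Lfun2P _).1 jL.
have nE n : ((rdot (@dotL2 R) (f_ n - toL2 gL) (f_ n - toL2 gL))%:E =
    \int[mu]_x ((Re (f_ n x) - r x) ^+ 2)%:E +
    \int[mu]_x ((Im (f_ n x) - j x) ^+ 2)%:E)%E.
  rewrite (@ae_sqr_norm_L2 _ (fun x => f_ n x - (r x +i* j x))); last exact: toL2_comb.
  - by congr (_ + _)%E; apply: eq_integral => x _; rewrite ?ReB ?ImB.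
  - rewrite (_ : _ \o _ = fun x => Re (f_ n x) - r x); last by apply/funext => x; rewrite /= ReB.
    exact: (measurable_funB (mRe (f_ n)) mr).
  - rewrite (_ : _ \o _ = fun x => Im (f_ n x) - j x); last by apply/funext => x; rewrite /= ImB.
    exact: (measurable_funB (mIm (f_ n)) mj).
have : (rdot (@dotL2 R) (f_ n - toL2 gL) (f_ n - toL2 gL))%:E @[n --> \oo] --> (0%:E : \bar R).
  under eq_fun do rewrite nE.
  by rewrite -(adde0 0%:E); apply: cvgeD.
move=> /fine_cvg /= c; rewrite /dot_cvg -[0]sqrtr0.
exact: (continuous_cvg _ (@sqrt_continuous _ 0) c).
Qed.

End ComplexL2Space.

(** * Smooth functions and the flat exponential *)

Section Smooth.
Variable R : realType.
Implicit Types f g : R -> R.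

(** Recursion through the first derivative makes closure under sums, products and affine
    substitution an induction that involves no formula for higher derivatives. *)
Fixpoint nsmooth (n : nat) f : Prop :=
  if n is n'.+1 then (forall x, derivable f x 1) /\ nsmooth n' f^`()%classic
  else True.

Lemma nsmooth_derivable n f k : nsmooth n f -> (k < n)%N ->
  forall x, derivable (f^`(k)%classic) x 1.
Proof.
elim: n f k => // n IHn f [|k] [df sf]; first by [].
rewrite ltnS => kn x; rewrite /derive1n iterSr; exact: IHn.
Qed.

Lemma derivable_nsmooth n f :
  (forall k x, derivable (f^`(k)%classic) x 1) -> nsmooth n f.
Proof.
elim: n f => // n IHn f df; split; first exact: (df 0%N).
by apply: IHn => k x; have := df k.+1 x; rewrite /derive1n iterSr.
Qed.

Lemma nsmoothS_is_derive n f f' : (forall x : R, is_derive x (1 : R) f (f' x)) ->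
  nsmooth n f' -> nsmooth n.+1 f.
Proof.
move=> df sf; split; first by move=> x; have [] := df x.
by rewrite (_ : f^`()%classic = f')//; apply/funext => x; rewrite derive1E; have [_ ->] := df x.
Qed.

Lemma nsmooth_is_derive n f : nsmooth n.+1 f ->
  forall x : R, is_derive x (1 : R) f (f^`()%classic x).
Proof. by move=> [df _] x; rewrite derive1E; exact: derivableP. Qed.

Lemma nsmoothW n f : nsmooth n.+1 f -> nsmooth n f.
Proof. by elim: n f => // n IHn f [df sf]; split => //; exact: IHn. Qed.

Lemma nsmoothD n f g : nsmooth n f -> nsmooth n g -> nsmooth n (fun x => f x + g x).
Proof.
elim: n f g => // n IHn f g sf sg.
apply: (@nsmoothS_is_derive _ _ (fun x => f^`()%classic x + g^`()%classic x)).
  move=> x; have := nsmooth_is_derive sf x; have := nsmooth_is_derive sg x.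
  by move=> ? ?; exact: is_deriveD.
by apply: IHn; [case: sf|case: sg].
Qed.

Lemma nsmoothM n f g : nsmooth n f -> nsmooth n g -> nsmooth n (fun x => f x * g x).
Proof.
elim: n f g => // n IHn f g sf sg.
apply: (@nsmoothS_is_derive _ _ (fun x => f x * g^`()%classic x + g x * f^`()%classic x)).
  move=> x; have := nsmooth_is_derive sf x; have := nsmooth_is_derive sg x.
  by move=> ? ?; exact: is_deriveM.
by apply: nsmoothD; apply: IHn; try exact: nsmoothW; [case: sg|case: sf].
Qed.

Lemma nsmooth_cst n (c : R) : nsmooth n (cst c).
Proof.
elim: n c => // n IHn c.
by apply: (@nsmoothS_is_derive n _ (cst 0)); exact: IHn.
Qed.

Lemma nsmooth_affine n f (c d : R) : nsmooth n f -> nsmooth n (fun x => f (c * x + d)).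
Proof.
elim: n f => // n IHn f sf.
apply: (@nsmoothS_is_derive _ _ (fun x => c * f^`()%classic (c * x + d))).
  move=> x; have := nsmooth_is_derive sf (c * x + d) => df.
  have da : is_derive x (1 : R) (fun x => c * x + d) c.
    by apply: is_derive_eq; rewrite ?addr0 /GRing.scale /= ?mulr1 ?mulr0 ?addr0.
  by rewrite mulrC; exact: (@is_derive1_comp _ f (fun x => c * x + d) x _ _ df da).
by apply: nsmoothM; [exact: nsmooth_cst|apply: IHn; case: sf].
Qed.

Lemma is_derive_flat0 f (C : R) : f 0 = 0 ->
  (forall h, `|h| <= 1 -> `|f h| <= C * h ^+ 2) -> is_derive (0 : R) (1 : R) f 0.
Proof.
move=> f0 fC.
have c : h^-1 *: (f (h *: 1 + 0) - f 0) @[h --> (0 : R)^'] --> (0 : R).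
  apply/cvgrPdist_le => e e0.
  have C1 : 0 < `|C| + 1 by rewrite ltr_wpDl.
  near=> h; have h0 : h != 0 by near: h; exact: nbhs_dnbhs_neq.
  have hh : 0 < `|h| by rewrite normr_gt0.
  have h1 : `|h| <= 1 by near: h; apply: dnbhs0_le.
  have he : `|h| <= e / (`|C| + 1) by near: h; apply: dnbhs0_le; rewrite divr_gt0.
  rewrite sub0r normrN f0 subr0 addr0 [h *: 1]mulr1 [_ *: _]/( _ * _) normrM normfV.
  rewrite mulrC ler_pdivrMr// (le_trans (fC _ h1))//.
  rewrite -(real_normK (num_real h)) expr2 mulrA ler_wpM2r//.
  rewrite ler_pdivlMr// in he; rewrite (le_trans _ he)// mulrC ler_wpM2l//.
  by have := ler_norm C; lra.
by split; [exact: (cvgP _ c)|exact: cvg_lim c].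
Unshelve. all: by end_near. Qed.

Lemma exprn_expRN_le (n : nat) (y : R) : 0 <= y -> y ^+ n * expR (- y) <= n%:R ^+ n.
Proof.
case: n => [|n] y0; first by rewrite !expr0 mul1r -expR0 ler_expR oppr_le0.
rewrite expRN ler_pdivrMr ?expR_gt0//.
have -> : expR y = expR (y / n.+1%:R) ^+ n.+1.
  by rewrite -expRM_natl -mulrC divfK// pnatr_eq0.
rewrite -exprMn lerXn2r ?nnegrE ?mulr_ge0 ?expR_ge0//.
have yE : y = n.+1%:R * (y / n.+1%:R) by rewrite mulrC divfK// pnatr_eq0.
by rewrite [leLHS]yE ler_wpM2l// (le_trans _ (expR_ge1Dx _))// lerDr.
Qed.

(** Exponential decay beats every power; with y = 1 / x this is the flatness at 0 of P(1 / x) exp(-1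
    / x). *)
Lemma poly_expRN_le (P : {poly R}) (k : nat) : exists C, forall y, 0 <= y ->
  `|P.[y] * expR (- y)| * y ^+ k <= C.
Proof.
elim/poly_ind: P k => [|P c IHP] k.
  by exists 0 => y _; rewrite horner0 mul0r normr0 mul0r.
have [C PC] := IHP k.+1; exists (C + `|c| * k%:R ^+ k) => y y0.
rewrite hornerMXaddC mulrDl (le_trans (ler_wpM2r _ (ler_normD _ _)))// ?exprn_ge0//.
rewrite mulrDl lerD//.
  by rewrite mulrAC normrM (ger0_norm y0) -mulrA -exprS PC.
rewrite normrM -mulrA ler_wpM2l// ger0_norm ?expR_ge0// mulrC.
exact: exprn_expRN_le.
Qed.

(** This family is closed under differentiation, P being replaced by X^2 (P - P'), so one induction
    shows all its members smooth. *)
Definition flat_poly (P : {poly R}) (x : R) : R :=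
  if 0 < x then P.[x^-1] * expR (- x^-1) else 0.

Lemma is_derive_flat_poly P x :
  is_derive x (1 : R) (flat_poly P) (flat_poly ('X^2 * (P - P^`())) x).
Proof.
have [x0|x0|->] := ltgtP x 0.
- rewrite {2}/flat_poly ltNge (ltW x0) /=.
  apply: (@near_eq_is_derive _ _ _ (cst 0)).
  near=> y; have y0 : y < 0 by near: y; exact: lt_nbhsl.
  by rewrite /flat_poly ltNge (ltW y0).
- rewrite {2}/flat_poly x0.
  pose g (y : R) : R := P.[y^-1] * expR (- y^-1).
  apply: (@near_eq_is_derive _ _ _ g).
    near=> y; have y0 : 0 < y by near: y; exact: lt_nbhsr.
    by rewrite /flat_poly y0.
  have xN0 : x != 0 by rewrite gt_eqF.
  rewrite /g; have dV : is_derive x (1 : R) (fun y : R => y^-1) (- x ^- 2 : R).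
    by apply: is_derive_eq (is_deriveV xN0 (is_derive_id x 1)) _; rewrite [_ *: _]mulr1.
  have dP := @is_derive1_comp _ (horner P) (fun y => y^-1) x _ _ (is_derive_poly P x^-1) dV.
  have dE := @is_derive1_comp _ expR (fun y => - y^-1) x _ _ (is_derive_expR (- x^-1)) (is_deriveN dV).
  apply: is_derive_eq (is_deriveM dP dE) _.
  rewrite /= !hornerE opprK exprVn.
  have scE (a b : R) : a *: (b : R^o) = a * b by [].
  by rewrite !scE; ring.
- rewrite {2}/flat_poly ltxx.
  (* The power 2 yields a bound by C h^2 near 0, as [is_derive_flat0] requires. *)
  have [C PC] := poly_expRN_le P 2.
  apply: (@is_derive_flat0 _ C); first by rewrite /flat_poly ltxx.
  move=> h _; rewrite /flat_poly; case: ltP => h0; last first.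
    rewrite normr0 mulr_ge0 ?sqr_ge0// (le_trans _ (PC 0 _))// mulr_ge0//.
  have := PC h^-1; rewrite invr_ge0 => /(_ (ltW h0)).
  by rewrite exprVn ler_pdivrMr ?exprn_gt0.
Unshelve. all: by end_near. Qed.

Lemma nsmooth_flat_poly n P : nsmooth n (flat_poly P).
Proof.
elim: n P => // n IHn P; apply: nsmoothS_is_derive; first exact: is_derive_flat_poly.
exact: IHn.
Qed.

Definition flat := flat_poly 1.

Lemma nsmooth_flat n : nsmooth n flat.
Proof. exact: nsmooth_flat_poly. Qed.

Lemma flatE x : flat x = if 0 < x then expR (- x^-1) else 0.
Proof. by rewrite /flat /flat_poly hornerC mul1r. Qed.

(* For k > 0, a smooth function supported in [a, b]; as k grows it increases to
   the indicator function of ]a, b[. *)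
Definition smooth_bump (k a b x : R) := flat (k * (x - a)) * flat (k * (b - x)).

Lemma nsmooth_bump n k a b : nsmooth n (smooth_bump k a b).
Proof.
rewrite (_ : smooth_bump k a b = fun x => flat (k * x + - (k * a)) * flat (- k * x + k * b)).
  by apply: nsmoothM; apply: nsmooth_affine; exact: nsmooth_flat.
by apply/funext => x; rewrite /smooth_bump !mulrBr mulNr [k * b - _]addrC.
Qed.

End Smooth.

(** * Test functions and bumps *)

Section TestFunctions.
Variable R : realType.
Local Notation mu := (@lebesgue_measure R).
Implicit Types phi psi : R -> R.

Lemma test_functionP phi : test_function phi <->
  (forall n, nsmooth n phi) /\ exists M : R, forall x : R, M < `|x| -> phi x = 0.
Proof.
split=> [[dphi cphi]|[sphi [M phi0]]]; split.
- by move=> n; exact: derivable_nsmooth.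
- have [M [_ phiM]] := compact_bounded cphi.
  exists (M + 1) => x xM; apply/eqP; apply: contraTT xM => x0.
  by rewrite -leNgt; apply: (phiM (M + 1)); [rewrite ltrDl|exact: subset_closure].
- by move=> n x; exact: (nsmooth_derivable (sphi n.+1)).
- apply: (@subclosed_compact _ _ `[- M, M]%classic).
  + exact: closed_closure.
  + exact: segment_compact.
  + rewrite [X in _ `<=` X](_ : _ = closure `[- M, M]%classic).
      apply: closure_subset => x /= x0; rewrite in_itv /= -ler_norml.
      by apply: contraNT x0; rewrite -ltNge => /phi0 ->.
    by apply/closure_id; exact: interval_closed.
Qed.

Lemma test_smooth phi n : test_function phi -> nsmooth n phi.
Proof. by move=> /test_functionP[]. Qed.

Lemma test_is_derive phi : test_function phi -> forall x : R,
  is_derive x (1 : R) phi (phi^`()%classic x).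
Proof. by move=> /test_smooth tphi; exact: (nsmooth_is_derive (tphi 1%N)). Qed.

Lemma smooth_continuous phi : nsmooth 1 phi -> continuous phi.
Proof. by move=> [dphi _] x; apply/differentiable_continuous/derivable1_diffP. Qed.

Lemma test_continuous phi : test_function phi -> continuous phi.
Proof. by move=> tphi; exact/smooth_continuous/test_smooth. Qed.

(** The derivative vanishes there too because |x| > M is an open condition. *)
Lemma test_support phi : test_function phi -> exists2 M : R, 0 < M &
  forall x : R, M < `|x| -> phi x = 0 /\ phi^`()%classic x = 0.
Proof.
move=> /test_functionP[_ [M phi0]]; exists (`|M| + 1); first by rewrite ltr_wpDl.
move=> x xM; have Mx : M < `|x|.
  by rewrite (le_lt_trans (ler_norm _))// (le_lt_trans _ xM)// lerDl.
split; first exact: phi0.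
rewrite derive1E (@near_eq_derive _ _ _ _ (cst 0)) ?derive_cst//.
near=> y; apply: phi0; near: y.
have /= := @norm_continuous _ R x.
by move=> /cvgr_gt; exact.
Unshelve. all: by end_near. Qed.

Lemma test_deriv phi : test_function phi -> test_function phi^`()%classic.
Proof.
move=> tphi; apply/test_functionP; split.
  by move=> n; have [] := test_smooth n.+1 tphi.
by have [M _ phi0] := test_support tphi; exists M => x /phi0[].
Qed.

Lemma test_shift phi t : test_function phi -> test_function (fun x => phi (x - t)).
Proof.
move=> tphi; have [M M0 phi0] := test_support tphi; apply/test_functionP; split.
  move=> n; rewrite (_ : (fun _ => _) = fun x => phi (1 * x + - t)).
    by apply: nsmooth_affine; exact: test_smooth.
  by apply/funext => x; rewrite mul1r.
exists (M + `|t|) => x xM; apply: (phi0 _ _).1.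
by rewrite -(ltrD2r `|t|) (lt_le_trans xM)// -[x in leLHS](subrK t) ler_normD.
Qed.

Lemma derive1_shift phi t : test_function phi ->
  (fun x => phi (x - t))^`()%classic = fun x => phi^`()%classic (x - t).
Proof.
move=> tphi; apply/funext => x; rewrite derive1E.
have ds : is_derive x (1 : R) (fun x => x - t) 1.
  by apply: is_derive_eq; rewrite subr0.
have [_ ->] := @is_derive1_comp _ phi (fun x => x - t) x _ _ (test_is_derive tphi (x - t)) ds.
by rewrite mulr1.
Qed.

Lemma test_mul phi psi : test_function phi -> test_function psi ->
  test_function (fun x => phi x * psi x).
Proof.
move=> tphi tpsi; apply/test_functionP; split.
  by move=> n; apply: nsmoothM; exact: test_smooth.
by have [M _ phi0] := test_support tphi; exists M => x /phi0[-> _]; rewrite mul0r.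
Qed.

Lemma flat_ge0 (x : R) : 0 <= flat x.
Proof. by rewrite flatE; case: ifP => // _; exact: expR_ge0. Qed.

Lemma flat_le1 (x : R) : flat x <= 1.
Proof.
by rewrite flatE; case: ifP => // x0; rewrite -expR0 ler_expR oppr_le0 invr_ge0 ltW.
Qed.

Lemma flat_gt0 (x : R) : 0 < x -> 0 < flat x.
Proof. by move=> x0; rewrite flatE x0 expR_gt0. Qed.

Lemma flat_eq0 (x : R) : x <= 0 -> flat x = 0.
Proof. by move=> x0; rewrite flatE ltNge x0. Qed.

Lemma bump_ge0 (k a b x : R) : 0 <= smooth_bump k a b x.
Proof. by rewrite mulr_ge0// flat_ge0. Qed.

Lemma bump_le1 (k a b x : R) : smooth_bump k a b x <= 1.
Proof. by rewrite mulr_ile1// ?flat_ge0// flat_le1. Qed.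

Lemma bump_eq0 (k a b x : R) : 0 < k -> ~~ (a < x < b) -> smooth_bump k a b x = 0.
Proof.
move=> k0; rewrite negb_and -!leNgt /smooth_bump => /orP[xa|bx].
  by rewrite flat_eq0 ?mul0r// pmulr_rle0// subr_le0.
by rewrite mulrC flat_eq0 ?mul0r// pmulr_rle0// subr_le0.
Qed.

Lemma test_bump (k a b : R) : 0 < k -> test_function (smooth_bump k a b).
Proof.
move=> k0; apply/test_functionP; split; first by move=> n; exact: nsmooth_bump.
exists (`|a| + `|b|) => x xab; apply: bump_eq0 => //.
apply: contraL xab => /andP[ax xb]; rewrite -leNgt ler_norml.
by have := ler_norm b; have := ler_norm (- a); rewrite normrN;
  have := normr_ge0 a; have := normr_ge0 b; move=> *; apply/andP; split; lra.
Qed.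

Lemma bump_gt0 (k a b x : R) : 0 < k -> a < x < b -> 0 < smooth_bump k a b x.
Proof.
by move=> k0 /andP[ax xb]; rewrite mulr_gt0// flat_gt0// mulr_gt0// subr_gt0.
Qed.

Lemma flat_cvg (y : R) : 0 < y -> flat (n.+1%:R * y) @[n --> \oo] --> (1 : R).
Proof.
move=> y0; have -> : (fun n => flat (n.+1%:R * y)) = fun n => expR (- (harmonic n * y^-1)).
  by apply/funext => n; rewrite flatE pmulr_rgt0// y0 invfM.
rewrite -expR0 -oppr0 -[in X in _ --> X](mul0r y^-1).
apply: continuous_cvg; first exact: continuous_expR.
apply: cvgN; apply: cvgM; [exact: cvg_harmonic|exact: cvg_cst].
Qed.

Lemma bump_cvg (a b x : R) : smooth_bump n.+1%:R a b x @[n --> \oo] --> (\1_`]a, b[ x : R).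
Proof.
rewrite indicE mem_setE in_itv /=; case: (boolP (_ && _)) => [/andP[ax xb]|xab].
  rewrite -subr_gt0 in ax; rewrite -subr_gt0 in xb.
  by rewrite -[X in _ --> X](mulr1 1); exact: (cvgM (flat_cvg ax) (flat_cvg xb)).
by under eq_fun do rewrite bump_eq0//; exact: cvg_cst.
Qed.

End TestFunctions.

(** * Testing L^2 functions against test functions; integration by parts *)

Section TestIntegrals.
Variable R : realType.
Local Notation mu := (@lebesgue_measure R).
Local Notation Lfun2 := (Lfun mu 2%:E).
Implicit Types phi psi : R -> R.

Lemma indic_Lfun2 (A : set (measurableTypeR R)) : measurable A -> (mu A < +oo)%E ->
  (\1_A : R -> R) \in Lfun2.
Proof.
move=> mA muA; apply/Lfun2P; split; first exact: measurable_indic.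
rewrite (eq_integral (fun x => (\1_A x)%:E)).
  by rewrite integral_indic// setIT.
by move=> x _; rewrite indicE; case: (_ \in _); rewrite ?expr1n ?expr0n.
Qed.

(** The indicator of a set of finite measure is in L^2, and its product with h is integrable. *)
Lemma Lfun2_integrable_fin h (A : set (measurableTypeR R)) : h \in Lfun2 ->
  measurable A -> (mu A < +oo)%E -> mu.-integrable A (EFin \o h).
Proof.
move=> hL mA muA; apply/(integrable_mkcond _ mA).
have := Lfun2_mul_integrable hL (indic_Lfun2 mA muA).
congr (integrable _ _ _); apply/funext => x /=.
by rewrite patchE indicE; case: (_ \in _); rewrite ?mulr1 ?mulr0.
Qed.

Lemma mu_itv_fin (a b : R) (p q : bool) :
  (mu ([set` Interval (BSide p a) (BSide q b)] : set (measurableTypeR R)) < +oo)%E.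
Proof.
by rewrite lebesgue_measure_itv /=; case: ifP => _; rewrite ?ltry// -EFinB ltry.
Qed.

Lemma Lfun2_locally_integrable h : h \in Lfun2 -> locally_integrable [set: R] h.
Proof.
move=> hL; split; [by case: ((Lfun2P h).1 hL)|exact: openT|move=> K _ cK].
have mK : measurable (K : set (measurableTypeR R)) by exact: compact_measurable.
by have /integrableP[] := Lfun2_integrable_fin hL mK (compact_finite_measure cK).
Qed.

(** Lebesgue differentiation: at almost every x the averages of h over shrinking balls, which are
    intervals, converge to h x. *)
Lemma integral_itv_eq0 h : h \in Lfun2 ->
  (forall a b : R, a < b -> (\int[mu]_(x in `]a, b[) (h x)%:E = 0)%E) ->
  {ae mu, forall x, h x = 0}.
Proof.
move=> hL h0; have locL := Lfun2_locally_integrable hL.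
have FF := ae_filter_ringOfSetsType mu.
apply: filterS (lebesgue_differentiation locL) => x xh.
pose E (x : R) (n : nat) : set R := ball x n.+1%:R^-1.
have p n : 0 < n.+1%:R^-1 :> R by rewrite invr_gt0.
have ns y : nicely_shrinking y (E y).
  split; first by move=> n; exact: measurable_ball.
  exists (1, fun n => PosNum (p n)); split => //=.
  - exact: cvg_harmonic.
  - by move=> n; exact: subset_refl.
  - by move=> n; rewrite mul1e.
have c := nice_lebesgue_differentiation ns locL xh.
suff E0 : (fun n => (mu (E x n))^-1 * \int[mu]_(y in E x n) (h y)%:E)%E = fun=> 0%E.
  rewrite E0 in c; apply: (@EFin_inj R).
  exact: (cvg_unique _ c (cvg_cst _)).
apply/funext => n; rewrite /E ball_itv h0 ?mule0//.
by rewrite ltrD2l gt0_cp.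
Qed.

(** The bumps converge to the indicator of ]a, b[, so by dominated convergence h integrates to 0
    over every bounded open interval. *)
Lemma Lfun2_test_eq0 h : h \in Lfun2 ->
  (forall phi, test_function phi -> (\int[mu]_x (h x * phi x))%R = 0) ->
  {ae mu, forall x, h x = 0}.
Proof.
move=> hL h0; apply: integral_itv_eq0 => // a b ab.
have mh : measurable_fun setT h by case: ((Lfun2P h).1 hL).
have mab : measurable (`]a, b[%classic : set (measurableTypeR R)) by [].
have ih : mu.-integrable setT (EFin \o (fun x => h x * \1_`]a, b[ x)).
  by apply: Lfun2_mul_integrable => //; apply: indic_Lfun2 => //; exact: mu_itv_fin.
pose f_ n x := (h x * smooth_bump n.+1%:R a b x)%:E.
have mf n : measurable_fun setT (fun x => h x * smooth_bump n.+1%:R a b x).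
  apply: measurable_funM => //; apply: continuous_measurable_fun.
  exact/test_continuous/test_bump.
have -> : (\int[mu]_(x in `]a, b[) (h x)%:E = \int[mu]_x (h x * \1_`]a, b[ x)%:E)%E.
  rewrite integral_mkcond; apply: eq_integral => x _.
  by rewrite patchE indicE; case: (_ \in _); rewrite ?mulr1 ?mulr0.
have f0 n : (\int[mu]_x f_ n x = 0)%E.
  have tb := @test_bump R n.+1%:R a b (ltr0Sn _ _).
  have := h0 _ tb; rewrite /Rintegral => /eqP.
  rewrite fine_eq0; last first.
    by apply: integrable_fin_num => //; apply: Lfun2_mul_integrable => //; exact: (test_function_L2 tb).1.
  by move/eqP.
have c : (\int[mu]_x f_ n x)%E @[n --> \oo] --> (\int[mu]_x (h x * \1_`]a, b[ x)%:E)%E.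
  have [] := @dominated_convergence _ _ _ mu setT measurableT f_
    (fun x => (h x * \1_`]a, b[ x)%:E) (fun x => `|(h x * \1_`]a, b[ x)%:E|%E) => //.
  - by move=> n; have := mf n; move/measurable_EFinP.
  - by have /integrableP[] := ih.
  - apply: aeW => x _; apply: cvg_EFin; first by near=> n.
    by apply: cvgM; [exact: cvg_cst|exact: bump_cvg].
  - exact: integrable_abse.
  - apply: aeW => x n _; rewrite /f_ lee_fin (normrM _ (smooth_bump _ _ _ _)) (normrM _ (\1_ _ _)) ler_wpM2l//.
    rewrite indicE mem_setE; case: (boolP (_ \in _)); rewrite in_itv /= => xab.
      by rewrite (ger0_norm (bump_ge0 _ _ _ _)) normr1 bump_le1.
    by rewrite bump_eq0// normr0.
have E0 : (fun n => \int[mu]_x f_ n x)%E = fun=> 0%E by exact/funext.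
by rewrite E0 in c; exact: (cvg_unique _ c (cvg_cst _)).
Unshelve. all: by end_near. Qed.

Lemma test_mul_integrable h phi : h \in Lfun2 -> test_function phi ->
  mu.-integrable setT (EFin \o (fun x => h x * phi x)).
Proof.
by move=> hL tphi; apply: Lfun2_mul_integrable => //; exact: (test_function_L2 tphi).1.
Qed.

Lemma integral_test_deriv phi : test_function phi ->
  (\int[mu]_x phi^`()%classic x)%R = 0.
Proof.
move=> tphi; have [M M0 phi0] := test_support tphi.
(* The interval extends one unit beyond the support on each side, so both boundary values vanish. *)
have ab : - (M + 1) < M + 1 by lra.
have z (x : R) : M < `|x| -> phi x = 0 by move=> /phi0[].
have e : (\int[mu]_(x in `[(- (M + 1))%R, (M + 1)%R]) (phi^`()%classic x)%:E = 0)%E.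
  rewrite (@continuous_FTC2 R phi^`()%classic phi _ _ ab).
  - by rewrite !z ?subee// ?normrN gtr0_norm; lra.
  - by apply: continuous_subspaceT; exact/test_continuous/test_deriv.
  - split; first by move=> x _; have [] := test_is_derive tphi x.
    + by apply: cvg_at_right_filter; exact: test_continuous.
    + by apply: cvg_at_left_filter; exact: test_continuous.
  - by [].
rewrite /Rintegral; apply/eqP; rewrite (_ : (\int[mu]_x _ = 0)%E)// -e.
rewrite [RHS]integral_mkcond; apply: eq_integral => x _; rewrite patchE.
case: ifPn => //; rewrite notin_setE /= in_itv /= -ler_norml => /negP.
by rewrite -ltNge => xM; have [] := phi0 x; [rewrite (lt_trans _ xM)// ltrDl|move=> _ ->].
Qed.

Lemma test_integration_by_parts phi psi : test_function phi -> test_function psi ->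
  (\int[mu]_x (phi x * psi^`()%classic x))%R =
  - (\int[mu]_x (psi x * phi^`()%classic x))%R.
Proof.
move=> tphi tpsi; have := integral_test_deriv (test_mul tphi tpsi).
have [phiL dphiL] := test_function_L2 tphi; have [psiL dpsiL] := test_function_L2 tpsi.
rewrite (_ : _^`()%classic = fun x => 1 * (phi x * psi^`()%classic x) + 1 * (psi x * phi^`()%classic x)).
  rewrite (Rintegral_lin _ _ _ _).2; try exact: Lfun2_mul_integrable.
  by rewrite !mul1r => /eqP; rewrite addr_eq0 => /eqP.
apply/funext => x; rewrite derive1E !mul1r.
by have [_ ->] := is_deriveM (test_is_derive tphi x) (test_is_derive tpsi x).
Qed.

End TestIntegrals.

(** * Correlation with a test function; bounded solutions of differential equations *)

Section Correlation.
Variable R : realType.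
Local Notation mu := (@lebesgue_measure R).
Local Notation Lfun2 := (Lfun mu 2%:E).
Implicit Types (h phi : R -> R) (F : R -> R).

(** Convolution of h with the reflection of phi: its value at t tests h against the translate of phi
    by t, so a weak equation for h with constant coefficients becomes a classical one in t. *)
Definition corr h phi (t : R) : R := (\int[mu]_x (h x * phi (x - t)))%R.

Lemma test_bounded phi : test_function phi ->
  exists M : R, exists C : R, [/\ 0 < M, 0 <= C &
    forall x : R, `|phi x| <= C * \1_`[- M, M] x].
Proof.
move=> tphi; have [M M0 phi0] := test_support tphi.
have cphi : {within `[- M, M], continuous (fun x => `|phi x|)}.
  apply: continuous_subspaceT => x; apply: continuous_comp; last exact: norm_continuous.
  exact: test_continuous.
have [|c _ cmax] := EVT_max _ cphi; first by rewrite ge0_cp// ltW.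
exists M, `|phi c|; split => // x; rewrite indicE mem_setE.
case: (boolP (_ \in _)) => xM; first by rewrite mulr1 cmax.
rewrite (phi0 x _).1 ?normr0 ?mulr0// ltNge; apply: contra xM.
by rewrite in_itv /= ler_norml.
Qed.

Lemma indic_itv_shift (M t x : R) :
  \1_`[- M, M] (x - t) = \1_`[t - M, t + M] x :> R.
Proof.
rewrite !indicE !mem_setE !in_itv /=; congr ((nat_of_bool _)%:R).
by congr (_ && _); apply/idP/idP; lra.
Qed.

Lemma corr_integrable h phi t : h \in Lfun2 -> test_function phi ->
  mu.-integrable setT (EFin \o (fun x => h x * phi (x - t))).
Proof. by move=> hL tphi; apply: test_mul_integrable => //; exact: test_shift. Qed.

(** Differentiation under the integral for parameters within distance 1 of t: the translates of phi'
    then vanish outside a fixed interval, and |h| times a constant on that interval is an integrable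
    majorant. *)
Lemma is_derive_corr h phi t : h \in Lfun2 -> test_function phi ->
  is_derive t (1 : R) (corr h phi) (- corr h phi^`()%classic t).
Proof.
move=> hL tphi; have [M [C [M0 C0 phiC]]] := test_bounded (test_deriv tphi).
pose f (s x : R) := h x * phi (x - s).
have df s x : is_derive s (1 : R) (f ^~ x) (- (h x * phi^`()%classic (x - s))).
  have ds : is_derive s (1 : R) (fun s => x - s) (- 1).
    by apply: is_derive_eq; rewrite add0r mul1r.
  have d1 := @is_derive1_comp _ phi (fun s => x - s) s _ _ (test_is_derive tphi (x - s)) ds.
  apply: is_derive_eq (is_deriveM (is_derive_cst (h x) s 1) d1) _.
  have scE (a b : R) : a *: (b : R^o) = a * b by [].
  by rewrite scaler0 addr0 scE mulrN1 mulrN.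
have It : `]t - 1, t + 1[%classic t by rewrite /= in_itv /=; apply/andP; split; lra.
have intf s : `]t - 1, t + 1[%classic s -> mu.-integrable setT (EFin \o f s).
  by move=> _; exact: corr_integrable.
have derf s x : `]t - 1, t + 1[%classic s -> setT x -> derivable (f ^~ x) s 1.
  by move=> _ _; have [] := df s x.
pose A : set (measurableTypeR R) := `[t - 1 - M, t + 1 + M]%classic.
pose G x := `|h x * (C * \1_A x)|.
have G0 x : 0 <= G x by exact: normr_ge0.
have iG : mu.-integrable setT (EFin \o G).
  have AL : (fun x => C * \1_A x) \in Lfun2.
    have mA : measurable A by exact: measurable_itv.
    have muA : (mu A < +oo)%E by exact: (mu_itv_fin _ _ true false).
    have AL := indic_Lfun2 mA muA.
    have := Lfun2_comb C 0 AL AL.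
    by under eq_fun do rewrite mul0r addr0.
  exact: integrable_abse (Lfun2_mul_integrable hL AL).
have Gub s x : `]t - 1, t + 1[%classic s -> setT x -> `|partial1of2 f s x| <= G x.
  rewrite /= in_itv /= => /andP[s1 s2] _; rewrite partial1of2E; have [_ ->] := df s x.
  rewrite normrN /G !normrM ler_wpM2l// (le_trans (phiC _))// (ger0_norm C0) ler_wpM2l//.
  rewrite indicE mem_setE in_itv /=; case: (boolP (_ && _)) => [/andP[? ?]|_]; last exact: normr_ge0.
  by rewrite indicE mem_set ?normr1// /A /= in_itv /=; apply/andP; split; lra.
split; first exact: (derivable_under_integral measurableT It intf derf G0 iG Gub).
rewrite -derive1E (differentiation_under_integral measurableT It intf derf G0 iG Gub).
rewrite -mulN1r -RintegralZl//; last exact/corr_integrable/test_deriv.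
by apply: eq_Rintegral => x _; rewrite partial1of2E; have [_ ->] := df t x; rewrite mulN1r.
Qed.

Lemma sqr_indic_integrable h (M t : R) : h \in Lfun2 ->
  mu.-integrable setT (EFin \o (fun x => h x ^+ 2 * \1_`[t - M, t + M] x)).
Proof.
move=> hL; pose A : set (measurableTypeR R) := `[t - M, t + M]%classic.
have mA : measurable A by exact: measurable_itv.
have : mu.-integrable A (EFin \o (fun x => h x ^+ 2)).
  by apply: (integrableS measurableT mA _ (Lfun2_integrable_sqr hL)).
move=> /(integrable_mkcond _ mA); congr (integrable _ _ _); apply/funext => x /=.
by rewrite patchE indicE; case: (_ \in _); rewrite ?mulr1 ?mulr0.
Qed.

(* The weight s separates the contribution of h near t from that of phi. *)
Lemma corr_le h phi : h \in Lfun2 -> test_function phi ->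
  exists M : R, exists C : R, [/\ 0 < M, 0 <= C & forall s t : R, 0 < s ->
    `|corr h phi t| <= s * C +
      s^-1 * (\int[mu]_x (h x ^+ 2 * \1_`[t - M, t + M] x))%R].
Proof.
move=> hL tphi; have [M [C [M0 C0 phiC]]] := test_bounded tphi.
exists M, (C ^+ 2 * (2 * M)); split; rewrite ?mulr_ge0 ?sqr_ge0 ?(ltW M0)// => s t s0.
pose A : set (measurableTypeR R) := `[t - M, t + M]%classic.
have mA : measurable A by exact: measurable_itv.
have muA : (mu A < +oo)%E by exact: (mu_itv_fin _ _ true false).
have AL := indic_Lfun2 mA muA.
have ih := sqr_indic_integrable M t hL.
have i1 : mu.-integrable setT (EFin \o (\1_A : R -> R)).
  have := Lfun2_mul_integrable AL AL; congr (integrable _ _ _); apply/funext => x /=.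
  by rewrite indicE; case: (_ \in _); rewrite ?mulr1 ?mulr0.
have [ilin elin] := Rintegral_lin (s * C ^+ 2) s^-1 i1 ih.
have e1 : (\int[mu]_x (\1_A x))%R = 2 * M.
  have muE : mu A = (2 * M)%:E.
    rewrite /A lebesgue_measure_itv /= lte_fin ifT; last by lra.
    by rewrite -EFinB; congr EFin; ring.
  have -> : (2 * M) = fine (mu A) by rewrite muE.
  by rewrite /Rintegral integral_indic// setIT.
rewrite e1 in elin.
have -> : s * (C ^+ 2 * (2 * M)) = s * C ^+ 2 * (2 * M) by ring.
rewrite -elin (le_trans (le_normr_Rintegral _ _))//; first exact: corr_integrable.
apply: le_Rintegral => //.
  have := integrable_abse (corr_integrable t hL tphi).
  by [].
move=> x _; rewrite normrM -mulrA.
have := phiC (x - t); rewrite indic_itv_shift -/A.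
set a := `|h x|; set b := `|phi _|.
have a0 : 0 <= a by exact: normr_ge0.
have b0 : 0 <= b by exact: normr_ge0.
rewrite -(real_normK (num_real (h x))) -/a indicE; case: (_ \in _).
  rewrite !mulr1 => bC.
  (* Young's inequality: s C^2 + a^2 / s dominates 2 a C, hence a b. *)
  have key : 0 <= (a - s * C) ^+ 2 / s by rewrite divr_ge0 ?sqr_ge0// ltW.
  have e : (a - s * C) ^+ 2 / s = s^-1 * a ^+ 2 - 2 * (a * C) + s * C ^+ 2.
    by field; rewrite gt_eqF.
  have ab : a * b <= a * C by rewrite ler_wpM2l.
  by rewrite e in key; have := mulr_ge0 a0 C0; lra.
by rewrite !mulr0 addr0 => bC; exact: mulr_ge0_le0.
Qed.

Lemma corr_bounded h phi : h \in Lfun2 -> test_function phi ->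
  exists C : R, forall t, `|corr h phi t| <= C.
Proof.
move=> hL tphi; have [M [C [_ _ le]]] := corr_le hL tphi.
exists (C + (\int[mu]_x (h x ^+ 2))%R) => t.
rewrite (le_trans (le 1 t ltr01))// mul1r invr1 mul1r lerD2l.
apply: le_Rintegral => //.
- exact: sqr_indic_integrable.
- exact: Lfun2_integrable_sqr.
- by move=> x _; rewrite indicE; case: (_ \in _); rewrite ?mulr1// mulr0 sqr_ge0.
Qed.

(** The mass of h^2 on a window moving to infinity tends to 0, so [corr_le] leaves |c| <= s C for
    every s > 0. *)
Lemma corr_cst_eq0 h phi c : h \in Lfun2 -> test_function phi ->
  (forall t, corr h phi t = c) -> c = 0.
Proof.
move=> hL tphi cE; have [M [C [M0 C0 le]]] := corr_le hL tphi.
have cvg0 : (\int[mu]_x (h x ^+ 2 * \1_`[n%:R - M, n%:R + M] x))%R @[n --> \oo] --> (0 : R).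
  pose f_ n x := (h x ^+ 2 * \1_`[n%:R - M, n%:R + M] x)%:E.
  have [] := @dominated_convergence _ _ _ mu setT measurableT f_ (fun=> 0%E)
    (fun x => (h x ^+ 2)%:E).
  - by move=> n; have /integrableP[] := sqr_indic_integrable M n%:R hL.
  - exact: measurable_cst.
  - apply: aeW => x _; apply: cvg_near_cst; near=> n.
    rewrite /f_ indicE mem_setE in_itv /= (_ : n%:R - M <= x = false) ?mulr0//.
    apply/negbTE; rewrite -ltNge ltrBrDr; near: n.
    exact: nbhs_infty_gtr.
  - exact: Lfun2_integrable_sqr.
  - apply: aeW => x n _; rewrite /f_ lee_fin indicE; case: (_ \in _).
      by rewrite mulr1 ger0_norm// sqr_ge0.
    by rewrite mulr0 normr0 sqr_ge0.
  move=> _ _; rewrite integral0; exact: fine_cvg.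
have sC s : 0 < s -> `|c| <= s * C.
  move=> s0; rewrite -[s * C]addr0 -(mulr0 s^-1).
  have c1 : s * C + s^-1 * (\int[mu]_x (h x ^+ 2 * \1_`[n%:R - M, n%:R + M] x))%R
      @[n --> \oo] --> s * C + s^-1 * 0.
    by apply: cvgD; [exact: cvg_cst|apply: cvgM => //; exact: cvg_cst].
  apply: ler_cvg_to (cvg_cst _) c1 _.
  by near=> n; rewrite -(cE n%:R); exact: le.
apply/eqP; rewrite -normr_le0; apply/ler_addgt0Pl => e e0.
have C1 : 0 < C + 1 by lra.
rewrite addr0 (le_trans (sC (e / (C + 1)) _)) ?divr_gt0//.
rewrite mulrAC ler_pdivrMr// ler_wpM2l ?(ltW e0)//; lra.
Unshelve. all: by end_near. Qed.

(** F t = F 0 exp(k t) is unbounded in one direction unless F 0 = 0. *)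
Lemma exp_bounded_eq0 F (k C : R) : k != 0 ->
  (forall t : R, is_derive t (1 : R) F (k * F t)) ->
  (forall t, `|F t| <= C) -> forall t, F t = 0.
Proof.
move=> k0 dF FC.
have dexp t : is_derive t (1 : R) (fun t => expR (- k * t)) (- k * expR (- k * t)).
  have da : is_derive t (1 : R) (fun t => - k * t) (- k).
    by apply: is_derive_eq; rewrite ?addr0 /GRing.scale /= ?mulr1 ?mulr0 ?addr0.
  by rewrite mulrC; exact: (@is_derive1_comp _ expR (fun t => - k * t) t _ _ (is_derive_expR _) da).
have dg t : is_derive t (1 : R) (fun t => F t * expR (- k * t)) 0.
  apply: is_derive_eq (is_deriveM (dF t) (dexp t)) _.
  have scE (a b : R) : a *: (b : R^o) = a * b by [].
  by rewrite !scE; ring.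
have Fexp t : F t = F 0 * expR (k * t).
  have := @is_derive_0_is_cst R (fun t => F t * expR (- k * t)) t 0 dg; rewrite mulr0 expR0 mulr1 => <-.
  by rewrite -mulrA -expRD mulNr addNr expR0 mulr1.
suff F0 : F 0 = 0 by move=> t; rewrite Fexp F0 mul0r.
apply/eqP; rewrite -normr_eq0 eq_le normr_ge0 andbT leNgt; apply/negP => F0.
have C0 : 0 <= C by exact: le_trans (FC 0).
(* The exponent there is C / |F 0|, and exp x >= 1 + x gives |F| >= |F 0| + C. *)
have := FC (k^-1 * (C / `|F 0|)); rewrite Fexp mulVKf// normrM (ger0_norm (expR_ge0 _)).
have := expR_ge1Dx (C / `|F 0|).
rewrite -(ler_pM2l F0) => h1 h2; have := le_trans h1 h2.
by rewrite mulrDr mulr1 mulrC divfK ?gt_eqF// gerDr leNgt F0.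
Qed.

(** A bounded convex function on the line is constant: a nonzero slope at t would make F rise, on
    one side of t, by more than its oscillation 2 C. *)
Lemma convex_bounded_deriv_eq0 F F' F'' (C : R) :
  (forall t : R, is_derive t (1 : R) F (F' t)) ->
  (forall t : R, is_derive t (1 : R) F' (F'' t)) ->
  (forall t, 0 <= F'' t) -> (forall t, `|F t| <= C) -> forall t, F'' t = 0.
Proof.
move=> dF dF' F''0 FC.
have mono F1 F1' : (forall t : R, is_derive t (1 : R) F1 (F1' t)) ->
    forall a b, a < b -> exists2 c, a < c < b & F1 b - F1 a = F1' c * (b - a).
  move=> d a b ab; have cF : {within `[a, b], continuous F1}.
    apply: continuous_subspaceT => x.
    by apply/differentiable_continuous/derivable1_diffP; have [] := d x.
  have [c cab e] := MVT ab (fun x _ => d x) cF.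
  by exists c => //; move: cab; rewrite in_itv.
have inc a b : a < b -> F' a <= F' b.
  by move=> ab; have [c _ e] := mono _ _ dF' _ _ ab; rewrite -subr_ge0 e mulr_ge0// subr_ge0 ltW.
have FCC a b : F b - F a <= 2 * C.
  by have := FC a; have := FC b; rewrite !ler_norml => /andP[? ?] /andP[? ?]; lra.
have F'0 t : F' t = 0.
  apply/eqP; rewrite eq_le !leNgt; apply/andP; split; apply/negP => Ft.
    have C0 : 0 <= C by exact: le_trans (FC 0).
    (* Over this length a slope of at least F' t raises F by at least 2 C + 1. *)
    pose b := t + (2 * C + 1) / F' t.
    have bt : t < b by rewrite ltrDl divr_gt0//; lra.
    have [c /andP[tc _] e] := mono _ _ dF _ _ bt.
    have := FCC t b; rewrite e; have := inc _ _ tc.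
    have : 0 <= b - t by rewrite subr_ge0 ltW.
    move=> h1 h2; have := ler_wpM2r h1 h2; rewrite {2}/b addrAC subrr add0r mulrC divfK ?gt_eqF//.
    by move=> ? ?; lra.
  have C0 : 0 <= C by exact: le_trans (FC 0).
  pose a := t + (2 * C + 1) / F' t.
  have at_ : a < t by rewrite gtrDl pmulr_rlt0 ?invr_lt0//; lra.
  have [c /andP[_ ct] e] := mono _ _ dF _ _ at_.
  have := FCC t a; rewrite -opprB e; have := inc _ _ ct.
  have : 0 <= t - a by rewrite subr_ge0 ltW.
  move=> h1 h2; have := ler_wpM2r h1 h2.
  have -> : F' t * (t - a) = - (2 * C + 1) by rewrite /a; field; rewrite lt_eqF.
  by move=> ? ?; lra.
move=> t; have [_ <-] := dF' t.
by rewrite (_ : F' = cst 0) ?derive_cst//; exact/funext.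
Qed.

End Correlation.

(** * The weak derivative as a skew-adjoint operator *)

Section WeakDerivative.
Variable R : realType.
Local Notation mu := (@lebesgue_measure R).
Local Notation Lfun2 := (Lfun mu 2%:E).
Local Notation Re := (@complex.Re R).
Local Notation Im := (@complex.Im R).
Local Notation L2 := (L2 R).
Local Notation dotL2 := (@dotL2 R).
Implicit Types (phi psi : R -> R).

Lemma corr_deriv (r : R -> R) phi t : test_function phi ->
  corr r phi^`()%classic t =
  (\int[mu]_x (r x * (fun y => phi (y - t))^`()%classic x))%R.
Proof. by move=> tphi; rewrite derive1_shift. Qed.

(** F = [corr r phi] is bounded and satisfies F' = k F, and F 0 is the integral to be shown zero.
    For k = 0 boundedness does not suffice: F is constant, and the decay of r at infinity is used
    through [corr_cst_eq0]. *)
Lemma real_weak_eigen_eq0 (r : R -> R) (k : R) : r \in Lfun2 ->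
  (forall phi, test_function phi ->
    (\int[mu]_x (r x * phi^`()%classic x))%R = - (k * (\int[mu]_x (r x * phi x))%R)) ->
  {ae mu, forall x, r x = 0}.
Proof.
move=> rL rk; apply: Lfun2_test_eq0 => // phi tphi.
have dF t : is_derive t (1 : R) (corr r phi) (k * corr r phi t).
  apply: is_derive_eq (is_derive_corr t rL tphi) _.
  by rewrite corr_deriv// rk ?opprK//; exact: test_shift.
suff /(_ 0) : forall t, corr r phi t = 0.
  by rewrite /corr; under eq_Rintegral do rewrite subr0.
have [k0|k0] := eqVneq k 0.
  have F0 t : corr r phi t = corr r phi 0.
    apply: (@is_derive_0_is_cst _ (corr r phi)) => s.
    by apply: is_derive_eq (dF s) _; rewrite k0 mul0r.
  by move=> t; rewrite F0; exact: corr_cst_eq0 F0.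
by have [C FC] := corr_bounded rL tphi; exact: exp_bounded_eq0 k0 dF FC.
Qed.

Lemma cintegral_mul_real (f : L2) phi :
  cintegral (fun x => f x * (phi x)%:C) =
  (\int[mu]_x (Re (f x) * phi x))%R +i* (\int[mu]_x (Im (f x) * phi x))%R.
Proof.
by congr (_ +i* _); apply: eq_Rintegral => x _; case: (L2fun f x) => a b /=;
  rewrite mulr0 ?subr0 ?add0r// addrC.
Qed.

Lemma weak_derivative_parts (f f' : L2) : weak_derivative f f' <->
  forall phi, test_function phi ->
    (\int[mu]_x (Re (f x) * phi^`()%classic x))%R = - (\int[mu]_x (Re (f' x) * phi x))%R /\
    (\int[mu]_x (Im (f x) * phi^`()%classic x))%R = - (\int[mu]_x (Im (f' x) * phi x))%R.
Proof.
split=> ff' phi tphi.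
  by have := ff' phi tphi; rewrite !cintegral_mul_real => -[-> ->].
by rewrite !cintegral_mul_real; have [-> ->] := ff' phi tphi.
Qed.

Lemma weak_derivative_lin (a : R[i]) (f f' g g' : L2) : weak_derivative f f' ->
  weak_derivative g g' -> weak_derivative (a *: f + g) (a *: f' + g').
Proof.
move=> ff' gg' phi tphi; have [phiL dphiL] := test_function_L2 tphi.
rewrite !cintegral_L2_lin; try exact: real_sqint.
by rewrite ff' // gg' // mulrN -opprD.
Qed.

Lemma ae_Rintegral_mul (f g : R -> R) phi : f \in Lfun2 -> g \in Lfun2 ->
  test_function phi -> {ae mu, forall x, f x = g x} ->
  (\int[mu]_x (f x * phi x))%R = (\int[mu]_x (g x * phi x))%R.
Proof.
move=> fL gL tphi fg; rewrite /Rintegral; congr fine.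
have FF := ae_filter_ringOfSetsType mu.
apply: ae_eq_integral => //.
- by have /integrableP[] := test_mul_integrable fL tphi.
- by have /integrableP[] := test_mul_integrable gL tphi.
- by apply: filterS fg => x /= ->.
Qed.

(** As k is real, the real and imaginary parts decouple. The values 1 and -1 serve skew-adjointness;
    the value 0 says that an L^2 function with zero derivative vanishes. *)
Lemma weak_derivative_eigen_eq0 (f : L2) (k : R) :
  weak_derivative f (k%:C *: f) -> f = 0.
Proof.
move=> /weak_derivative_parts fk; apply: L2_ext.
have FF := ae_filter_ringOfSetsType mu.
have [aeR aeI] : {ae mu, forall x, Re ((k%:C *: f : L2) x) = k * Re (f x)} /\
    {ae mu, forall x, Im ((k%:C *: f : L2) x) = k * Im (f x)}.
  split; move: (L2fun_lin k%:C f 0) (@L2fun0 R); apply: filterS2 => x;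
    rewrite addr0 => -> ->; rewrite addr0; case: (L2fun f x) => a b /=; ring.
have kL h : h \in Lfun2 -> (fun x => k * h x) \in Lfun2.
  by move=> hL; have := Lfun2_comb k 0 hL hL; under eq_fun do rewrite mul0r addr0.
have kI h phi : h \in Lfun2 -> test_function phi ->
    (\int[mu]_x (k * h x * phi x))%R = k * (\int[mu]_x (h x * phi x))%R.
  move=> hL tphi; rewrite -RintegralZl//; last exact: test_mul_integrable.
  by apply: eq_Rintegral => x _; rewrite mulrA.
have r0 : {ae mu, forall x, Re (f x) = 0}.
  apply: (@real_weak_eigen_eq0 (Re \o f) k); first exact: Re_L2.
  move=> phi tphi; rewrite (fk phi tphi).1; congr (- _).
  rewrite (ae_Rintegral_mul (Re_L2 (k%:C *: f)) (kL _ (Re_L2 f)) tphi aeR).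
  exact: (kI _ _ (Re_L2 f)).
have j0 : {ae mu, forall x, Im (f x) = 0}.
  apply: (@real_weak_eigen_eq0 (Im \o f) k); first exact: Im_L2.
  move=> phi tphi; rewrite (fk phi tphi).2; congr (- _).
  rewrite (ae_Rintegral_mul (Im_L2 (k%:C *: f)) (kL _ (Im_L2 f)) tphi aeI).
  exact: (kI _ _ (Im_L2 f)).
move: r0 j0 (@L2fun0 R); apply: filterS3 => x /= r1 j1 ->.
by apply/eqP; rewrite eq_complex /= r1 j1 !eqxx.
Qed.

Lemma weak_derivative_unique (f g h : L2) :
  weak_derivative f g -> weak_derivative f h -> g = h.
Proof.
move=> /weak_derivative_parts fg /weak_derivative_parts fh; apply: L2_ext.
have FF := ae_filter_ringOfSetsType mu.
have diff0 (u v : R -> R) : u \in Lfun2 -> v \in Lfun2 ->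
    (forall phi, test_function phi -> (\int[mu]_x (u x * phi x))%R = (\int[mu]_x (v x * phi x))%R) ->
    {ae mu, forall x, u x = v x}.
  move=> uL vL uv; have : {ae mu, forall x, u x - v x = 0}.
    apply: (Lfun2_test_eq0 (Lfun2B uL vL)) => phi tphi.
    have [_] := Rintegral_lin 1 (-1) (test_mul_integrable uL tphi) (test_mul_integrable vL tphi).
    rewrite uv// mul1r mulN1r subrr => <-; apply: eq_Rintegral => x _.
    by rewrite mul1r mulN1r mulrBl.
  by apply: filterS => x /subr0_eq.
have r0 : {ae mu, forall x, Re (g x) = Re (h x)}.
  apply: (diff0 _ _ (Re_L2 g) (Re_L2 h)) => phi tphi; apply: oppr_inj.
  by rewrite -(fg phi tphi).1 -(fh phi tphi).1.
have j0 : {ae mu, forall x, Im (g x) = Im (h x)}.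
  apply: (diff0 _ _ (Im_L2 g) (Im_L2 h)) => phi tphi; apply: oppr_inj.
  by rewrite -(fg phi tphi).2 -(fh phi tphi).2.
move: r0 j0; apply: filterS2 => x /= r1 j1.
by apply/eqP; rewrite eq_complex r1 j1 !eqxx.
Qed.

Definition testL2 phi (tphi : test_function phi) : L2 :=
  toL2 (real_sqint (test_function_L2 tphi).1).

Lemma testL2_parts phi (tphi : test_function phi) :
  {ae mu, forall x, Re (testL2 tphi x) = phi x} /\
  {ae mu, forall x, Im (testL2 tphi x) = 0}.
Proof.
have FF := ae_filter_ringOfSetsType mu.
by split; have := toL2E (real_sqint (test_function_L2 tphi).1); apply: filterS => x ->.
Qed.

Lemma dotL2_test (f : L2) phi (tphi : test_function phi) :
  dotL2 f (testL2 tphi) = cintegral (fun x => f x * (phi x)%:C).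
Proof.
have FF := ae_filter_ringOfSetsType mu.
have meas (k : R -> R) : mu.-integrable setT (EFin \o k) -> measurable_fun setT k.
  by move=> /integrableP[/measurable_EFinP].
have [lr li] := sqint_mul (L2fun_sqint f) (conj_sqint (L2fun_sqint (testL2 tphi))).
have [kr ki] := sqint_mul (L2fun_sqint f) (real_sqint (test_function_L2 tphi).1).
apply: ae_eq_cintegral; [exact: meas..|].
apply: filterS (toL2E (real_sqint (test_function_L2 tphi).1)) => x.
rewrite /testL2 => ->; congr (_ * _).
by apply/eqP; rewrite eq_complex /= oppr0 !eqxx.
Qed.

Lemma weak_derivative_test phi (tphi : test_function phi) :
  weak_derivative (testL2 tphi) (testL2 (test_deriv tphi)).
Proof.
apply/weak_derivative_parts => psi tpsi.
have [phiR phiI] := testL2_parts tphi.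
have [dphiR dphiI] := testL2_parts (test_deriv tphi).
have [phiL dphiL] := test_function_L2 tphi.
have z0 : (fun=> 0 : R) \in Lfun2 by have [] := Lfun_submod_closed mu (lee1n 2).
split.
  rewrite (ae_Rintegral_mul (Re_L2 _) phiL (test_deriv tpsi) phiR).
  rewrite (ae_Rintegral_mul (Re_L2 _) dphiL tpsi dphiR).
  rewrite test_integration_by_parts//; congr (- _).
  by apply: eq_Rintegral => x _; rewrite mulrC.
rewrite (ae_Rintegral_mul (Im_L2 _) z0 (test_deriv tpsi) phiI).
rewrite (ae_Rintegral_mul (Im_L2 _) z0 tpsi dphiI).
have zI (k : R -> R) : (\int[mu]_x (0 * k x))%R = 0.
  rewrite /Rintegral (eq_integral (fun=> 0%E)) ?integral0// => x _.
  by rewrite mul0r.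
by rewrite !zI oppr0.
Qed.

(* Allowing complex multiples makes the real-bilinear relation [adj] test both
   the real and the imaginary part of a weak derivative. *)
Definition test_pair (g g' : L2) : Prop :=
  exists (c : R[i]) phi (tphi : test_function phi),
    g = c *: testL2 tphi /\ g' = c *: testL2 (test_deriv tphi).

Lemma weak_derivative_test_pair (g g' : L2) : test_pair g g' -> weak_derivative g g'.
Proof.
move=> [c [phi [tphi [-> ->]]]]; have tt' := weak_derivative_test tphi.
(* [weak_derivative_lin] always adds a second term, so c x is written (c - 1) x + x. *)
have e (x : L2) : (c - 1) *: x + x = c *: x by rewrite scalerBl scale1r subrK.
by rewrite -!e; exact: weak_derivative_lin.
Qed.

(** Through this identification the abstract results on [adj] apply to the weak derivative. *)
Lemma weak_derivative_adj (f f' : L2) :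
  weak_derivative f f' <-> adj dotL2 test_pair f f'.
Proof.
have dotZr (c : R[i]) (x y : L2) : dotL2 x (c *: y) = c^* * dotL2 x y.
  rewrite (inner_conj (dotL2_inner R) (c *: y) x) (inner_conj (dotL2_inner R) y x).
  by rewrite (dotZl (dotL2_inner R)) rmorphM.
split.
  move=> ff' g g' [c [phi [tphi [-> ->]]]]; rewrite /rdot !dotZr !dotL2_test.
  rewrite (ff' _ tphi) mulrN; case: (_ * _) => a b /=.
  by rewrite addNr.
move=> ff' phi tphi.
have e c := ff' _ _ (ex_intro _ c (ex_intro _ phi (ex_intro _ tphi (conj erefl erefl)))).
(* The multiples 1 and i give the real and the imaginary part of the weak identity. *)
have := e 1; have := e 'i; rewrite /rdot !dotZr !dotL2_test.
case: (cintegral _) => a b; case: (cintegral _) => c d /=.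
rewrite !(mul0r, mul1r, mulN1r, oppr0, sub0r, opprK, subr0) => h1 h2.
by congr (_ +i* _); lra.
Qed.

(** Integration by parts on H^1: [adj_skew] applies because u' = u and u' = -u have no nonzero
    solution in L^2. *)
Lemma weak_skew (f f' g g' : L2) : weak_derivative f f' -> weak_derivative g g' ->
  rdot dotL2 f g' + rdot dotL2 f' g = 0.
Proof.
move=> /weak_derivative_adj ff' /weak_derivative_adj gg'.
apply: (adj_skew (dotL2_inner R) (@L2_complete R) _ _ _ ff' gg').
- by move=> u u' /weak_derivative_test_pair uu'; exact/weak_derivative_adj.
- move=> u /weak_derivative_adj uu; apply: (@weak_derivative_eigen_eq0 u 1).
  by rewrite scale1r.
- move=> u /weak_derivative_adj uu; apply: (@weak_derivative_eigen_eq0 u (-1)).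
  by rewrite rmorphN1 scaleN1r.
Qed.

(** A vector g orthogonal to the range of k + D satisfies D g = k^* g, and skewness then gives Re k
    times its squared norm equal to 0. *)
Lemma weak_onto (k : R[i]) (h : L2) : Re k != 0 ->
  exists f f', [/\ weak_derivative f f', f' + k *: f = h &
    `|Re k| * dot_norm dotL2 f <= dot_norm dotL2 h].
Proof.
move=> k0.
have skew f f' : adj dotL2 test_pair f f' -> rdot dotL2 f' f = 0.
  move=> /weak_derivative_adj ff'; have := weak_skew ff' ff'.
  by rewrite (rdotC (dotL2_inner R) f); lra.
have [|f [f' [ff' eh]]] := adj_range (dotL2_inner R) (@L2_complete R) k0 skew _ h.
  move=> g gD; have gk : weak_derivative g (k^* *: g).
    apply/weak_derivative_adj => u u' uu'.
    have /gD : adj dotL2 test_pair u u'.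
      exact/weak_derivative_adj/weak_derivative_test_pair.
    rewrite (rdotDr (dotL2_inner R)) (rdot_adj (dotL2_inner R)).
    by rewrite conjCK.
  have := weak_skew gk gk; rewrite (rdotC (dotL2_inner R) g) (rdot_scale_self (dotL2_inner R)).
  move=> e; apply: (inner_eq0 (dotL2_inner R)); apply/eqP.
  have /eqP : Re k * rdot dotL2 g g = 0 by move: e; case: (k) => a b /=; lra.
  by rewrite mulf_eq0 (negbTE k0).
exists f, f'; split => //; first exact/weak_derivative_adj.
by rewrite -eh; apply: skew_lower_bound => //; [exact: (dotL2_inner R)|exact: skew].
Qed.

Lemma weak_derivative_closed (f_ f'_ : nat -> L2) (f f' : L2) :
  (forall n, weak_derivative (f_ n) (f'_ n)) ->
  dot_cvg dotL2 f_ f -> dot_cvg dotL2 f'_ f' -> weak_derivative f f'.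
Proof.
move=> ff ? ?; apply/weak_derivative_adj.
by apply: (@adj_closed _ _ _ (dotL2_inner R) _ f_ f'_) => // n; exact/weak_derivative_adj.
Qed.

Lemma test_bump01 : test_function (@smooth_bump R 1 0 1).
Proof. exact: test_bump. Qed.

(* Correlating with the bump b itself, w'' = b would give a bounded function
   with second derivative the autocorrelation of b, which is nonnegative and
   positive at 0. *)
Lemma bump_not_second_derivative (w g : L2) :
  weak_derivative w g -> weak_derivative g (testL2 test_bump01) -> False.
Proof.
set b := smooth_bump _ _ _; have tb := test_bump01 : test_function b.
move=> /weak_derivative_parts wg /weak_derivative_parts gb.
have [bR _] := testL2_parts test_bump01.
have bL := (test_function_L2 tb).1.
have d1 t : is_derive t (1 : R) (corr (Re \o w) b) (corr (Re \o g) b t).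
  apply: is_derive_eq (is_derive_corr t (Re_L2 w) tb) _.
  by rewrite corr_deriv// (wg _ (test_shift t tb)).1 opprK.
have d2 t : is_derive t (1 : R) (corr (Re \o g) b) (corr b b t).
  apply: is_derive_eq (is_derive_corr t (Re_L2 g) tb) _.
  rewrite corr_deriv// (gb _ (test_shift t tb)).1 opprK.
  exact: (ae_Rintegral_mul (Re_L2 _) bL (test_shift t tb) bR).
have pos t : 0 <= corr b b t.
  by apply: Rintegral_ge0 => x _; rewrite mulr_ge0// bump_ge0.
have [C FC] := corr_bounded (Re_L2 w) tb.
have := convex_bounded_deriv_eq0 d1 d2 pos FC 0.
(* The second derivative at 0 is the squared norm of b, so b would vanish almost everywhere,
   although it is positive on ]0, 1[. *)
have -> : corr b b 0 = rdot dotL2 (testL2 test_bump01) (testL2 test_bump01).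
  rewrite /rdot dotL2_test cintegral_mul_real /=.
  rewrite (ae_Rintegral_mul (Re_L2 _) bL tb bR) /corr.
  by apply: eq_Rintegral => x _; rewrite subr0.
move=> /(inner_eq0 (dotL2_inner R)) b0.
have FF := ae_filter_ringOfSetsType mu.
have : {ae mu, forall x, b x = 0}.
  move: bR (@L2fun0 R); rewrite b0; apply: filterS2 => x bx zx.
  by rewrite /b -bx zx.
move=> [N [mN N0 bN]].
have : (mu (`]0%R, 1%R[%classic : set (measurableTypeR R)) <= mu N)%E.
  apply: le_measure; rewrite ?inE//.
  move=> x /=; rewrite in_itv /= => x01; apply: bN => /= bx.
  by have := @bump_gt0 R 1 0 1 x ltr01 x01; rewrite -/b bx ltxx.
by rewrite [X in (_ <= X)%E]N0 lebesgue_measure_itv /= lte_fin ltr01 -EFinB lee_fin subr0 leNgt ltr01.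
Qed.

End WeakDerivative.

(** * A criterion for membership in the resolvent set *)

(** Injectivity of l - A makes any choice of preimages linear, and the estimate on the chosen
    preimages makes it bounded. *)
Lemma resolvent_of_onto (R : realType) (V : lmodType R[i]) (dot : V -> V -> R[i])
    (A : operator V) (l : R[i]) (M : R) :
  (forall a x y, dom A x -> dom A y ->
    dom A (a *: x + y) /\ A (a *: x + y) = a *: A x + A y) ->
  (forall x, dom A x -> A x = l *: x -> x = 0) ->
  (forall w, exists x, [/\ dom A x, l *: x - A x = w &
    dot_norm dot x <= M * dot_norm dot w]) ->
  resolvent_set dot A l.
Proof.
move=> Alin ker onto; have [S Sw] := choice onto.
have inj x y : dom A x -> dom A y -> l *: x - A x = l *: y - A y -> x = y.
  move=> dx dy e; have [d ed] := Alin (-1) y x dy dx.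
  rewrite !scaleN1r ![- _ + _]addrC in d ed; apply/subr0_eq/ker => //.
  by rewrite ed scalerBr -[A x](subKr (l *: x)) e -addrA -opprD subrK.
have Slin : linear S.
  move=> a x y; have [d1 e1 _] := Sw x; have [d2 e2 _] := Sw y.
  have [d e _] := Sw (a *: x + y).
  have [d' e'] := Alin a _ _ d1 d2.
  apply: inj => //; rewrite e e' -{1}e1 -{1}e2 !scalerDr !scalerN opprD !scalerA (mulrC l).
  by rewrite addrACA.
pose SL : {linear V -> V} := HB.pack S (GRing.isLinear.Build _ _ _ _ S Slin).
exists SL; split.
- by exists M => w; have [] := Sw w.
- by move=> w; have [] := Sw w.
- by move=> z dz; apply: inj => //; have [] := Sw (l *: z - A z).
Qed.

(** * The damped wave operator: domain, dissipativity, closedness and resolvent *)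

Section DampedWaveOperator.
Variables (R : realType) (m : R).
Hypothesis m_gt0 : 0 < m.
Local Notation Re := (@complex.Re R).
Local Notation Im := (@complex.Im R).
Local Notation L2 := (L2 R).
Local Notation H1 := (H1 R).
Local Notation dotL2 := (@dotL2 R).
Local Notation norm := (dot_norm dotL2).
Local Notation normX := (dot_norm (dotX m)).
Local Notation rd := (rdot dotL2).
Local Notation X := (Xspace R).
Let ip := dotL2_inner R.

Lemma wderivE (u g : L2) : weak_derivative u g -> wderiv u = g.
Proof.
move=> ug; rewrite /wderiv; case: xgetP => [h _ /= uh|/(_ g) //].
exact: weak_derivative_unique uh ug.
Qed.

Lemma wderivP (u : L2) : u \in @H1_pred R -> weak_derivative u (wderiv u).
Proof. by move=> /asboolP[g ug]; rewrite (wderivE ug). Qed.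

Lemma H1_wderiv (u : H1) : weak_derivative u (wderiv u).
Proof. exact/wderivP/H1P. Qed.

Lemma H1_lin (a : R[i]) (u v : H1) : H1val (a *: u + v) = a *: H1val u + H1val v.
Proof. by []. Qed.

Lemma wderiv_lin (a : R[i]) (u v : H1) :
  wderiv (H1val (a *: u + v)) = a *: wderiv u + wderiv v.
Proof. by apply: wderivE; apply: weak_derivative_lin; exact: H1_wderiv. Qed.

Lemma wderivB (u v : H1) : wderiv (H1val (u - v)) = wderiv u - wderiv v.
Proof. by have := wderiv_lin (-1) v u; rewrite !scaleN1r ![- _ + _]addrC. Qed.

Lemma normX_sqr (z : X) :
  normX z ^+ 2 = m * norm (H1val z.1) ^+ 2 + norm (wderiv z.1) ^+ 2 + norm z.2 ^+ 2.
Proof.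
have e : complex.Re (dotX m z z) =
    m * norm (H1val z.1) ^+ 2 + norm (wderiv z.1) ^+ 2 + norm z.2 ^+ 2.
  rewrite !(norm_sqr ip) /dotX /rdot.
  by case: (Defs.dotL2 z.1 z.1) (Defs.dotL2 (wderiv _) _) (Defs.dotL2 _ z.2)
    => [a b] [c d] [e f] /=; rewrite mul0r subr0.
rewrite {1}/dot_norm sqr_sqrtr e//.
by rewrite !addr_ge0 ?sqr_ge0// mulr_ge0 ?sqr_ge0// ltW.
Qed.

Lemma normX_ge (z : X) : [/\ Num.sqrt m * norm (H1val z.1) <= normX z,
  norm (wderiv z.1) <= normX z & norm z.2 <= normX z].
Proof.
have n0 (V : lmodType R[i]) (d : V -> V -> R[i]) (x : V) : 0 <= dot_norm d x by exact: norm_ge0.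
have sm : 0 <= Num.sqrt m by exact: sqrtr_ge0.
have a0 := mulr_ge0 (ltW m_gt0) (sqr_ge0 (norm (H1val z.1))).
have b0 := sqr_ge0 (norm (wderiv z.1)); have c0 := sqr_ge0 (norm z.2).
have x0 : 0 <= normX z by exact: n0.
have sE : Num.sqrt m ^+ 2 = m by rewrite sqr_sqrtr ?(ltW m_gt0).
split; rewrite -(@ler_pXn2r _ 2)// ?nnegrE ?n0 ?mulr_ge0 ?n0// normX_sqr; last 2 first.
- by rewrite -addrA addrCA lerDl addr_ge0.
- by rewrite lerDr addr_ge0.
by rewrite exprMn sE -addrA lerDl addr_ge0.
Qed.

Lemma normX_le (z : X) :
  normX z <= Num.sqrt m * norm (H1val z.1) + norm (wderiv z.1) + norm z.2.
Proof.
have n0 (V : lmodType R[i]) (d : V -> V -> R[i]) (x : V) : 0 <= dot_norm d x by exact: norm_ge0.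
have sm : 0 <= Num.sqrt m by exact: sqrtr_ge0.
have a0 : 0 <= Num.sqrt m * norm (H1val z.1) by rewrite mulr_ge0.
rewrite -(@ler_pXn2r _ 2)// ?nnegrE ?addr_ge0// normX_sqr.
rewrite -{1}(sqr_sqrtr (ltW m_gt0)) -exprMn.
have := mulr_ge0 a0 (n0 _ dotL2 (wderiv z.1)); have := mulr_ge0 a0 (n0 _ dotL2 z.2).
have := mulr_ge0 (n0 _ dotL2 (wderiv z.1)) (n0 _ dotL2 z.2).
by set a := _ * norm (H1val z.1); nra.
Qed.

(** With [opA_domP], this describes the domain by weak derivatives v' of v and w'' of u' + v', so
    that the default values in [opA] are dealt with once. *)
Lemma opA_domI (z : X) (v' w'' : L2) :
  weak_derivative z.2 v' -> weak_derivative (wderiv z.1 + v') w'' ->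
  [/\ dom (opA m) z, H1val (opA m z).1 = z.2 & (opA m z).2 = w'' - m%:C *: H1val z.1].
Proof.
move=> vv' ww''.
have uv : weak_derivative (H1val z.1 + z.2) (wderiv z.1 + v').
  by have := weak_derivative_lin 1 (H1_wderiv z.1) vv'; rewrite !scale1r.
have vH : z.2 \in @H1_pred R by apply/asboolP; exists v'.
split.
- by split=> //; apply/asboolP; exists (wderiv z.1 + v'), w''.
- by rewrite /= (insubdK _ vH).
- by rewrite /= (wderivE uv) (wderivE ww'').
Qed.

Lemma opA_domP (z : X) : dom (opA m) z -> exists v' w'' : L2,
  weak_derivative z.2 v' /\ weak_derivative (wderiv z.1 + v') w''.
Proof.
move=> [/asboolP[v' vv'] /asboolP[g [h [wg gh]]]]; exists v', h; split => //.
have uv : weak_derivative (H1val z.1 + z.2) (wderiv z.1 + v').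
  by have := weak_derivative_lin 1 (H1_wderiv z.1) vv'; rewrite !scale1r.
by rewrite (weak_derivative_unique uv wg).
Qed.

Lemma opA_lin (a : R[i]) (x y : X) : dom (opA m) x -> dom (opA m) y ->
  dom (opA m) (a *: x + y) /\ opA m (a *: x + y) = a *: opA m x + opA m y.
Proof.
move=> /opA_domP[v1 [w1 [vv1 ww1]]] /opA_domP[v2 [w2 [vv2 ww2]]].
have [_ ex1 ex2] := opA_domI vv1 ww1; have [_ ey1 ey2] := opA_domI vv2 ww2.
have [||d e1 e2] := @opA_domI (a *: x + y) (a *: v1 + v2) (a *: w1 + w2).
- exact: weak_derivative_lin.
- rewrite wderiv_lin addrACA -scalerDr; exact: weak_derivative_lin.
split => //; rewrite [LHS]surjective_pairing [RHS]surjective_pairing; congr pair.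
  by apply: val_inj; rewrite [LHS]e1 [RHS]H1_lin ex1 ey1.
have -> : (a *: opA m x + opA m y).2 = a *: (opA m x).2 + (opA m y).2 by [].
by rewrite e2 ex2 ey2 H1_lin scalerBr scalerDr opprD addrACA !scalerA (mulrC a).
Qed.

(** Integration by parts of w'' against v. In the inner product of X, the terms in <u', v'> and <u,
    v> cancel against those from the first component of A z. *)
Lemma dissipation (z : X) (v' w'' : L2) :
  weak_derivative z.2 v' -> weak_derivative (wderiv z.1 + v') w'' ->
  rd (w'' - m%:C *: H1val z.1) z.2 = - rd (wderiv z.1) v' - rd v' v' - m * rd (H1val z.1) z.2.
Proof.
move=> vv' ww''; have := weak_skew ww'' vv'.
rewrite !(rdotDl ip) (rdotNl ip) (rdotZl ip); lra.
Qed.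

Lemma opA_dissipative : dissipative (dotX m) (opA m).
Proof.
move=> z /opA_domP[v' [w'' [vv' ww'']]].
have [_ e1 e2] := opA_domI vv' ww''.
have := dissipation vv' ww''.
rewrite /dotX e1 e2 (wderivE vv') => dis.
have -> : Re (m%:C * dotL2 z.2 z.1 + dotL2 v' (wderiv z.1) + dotL2 (w'' - m%:C *: H1val z.1) z.2)
    = m * rd z.2 (H1val z.1) + rd v' (wderiv z.1) + rd (w'' - m%:C *: H1val z.1) z.2.
  rewrite /rdot; case: (Defs.dotL2 z.2 z.1) => a b; case: (Defs.dotL2 v' _) => c d.
  by case: (Defs.dotL2 _ z.2) => e f /=; rewrite mul0r subr0.
rewrite dis (rdotC ip z.2) (rdotC ip v' (wderiv _)).
by have := rdot_ge0 ip v'; lra.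
Qed.

(** The first component of A z_n is v_n, and its convergence in H^1 includes that of v_n'. The
    second component gives the convergence of w_n'' = m u_n + (A z_n).2, and the weak derivative is
    closed. *)
Lemma opA_closed : closed_operator (dotX m) (opA m).
Proof.
move=> z_ z w domz cz cA.
have sm : 0 < Num.sqrt m by rewrite sqrtr_gt0.
have compU (y_ : nat -> X) y : dot_cvg (dotX m) y_ y ->
    dot_cvg dotL2 (fun n => H1val (y_ n).1) (H1val y.1).
  move=> cy; apply: (dot_cvg_le (e_ := fun n => (Num.sqrt m)^-1 * normX (y_ n - y))).
    by move=> n; rewrite ler_pdivlMl//; have [] := normX_ge (y_ n - y).
  by rewrite -(mulr0 (Num.sqrt m)^-1); apply: cvgM => //; exact: cvg_cst.
have compU' (y_ : nat -> X) y : dot_cvg (dotX m) y_ y ->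
    dot_cvg dotL2 (fun n => wderiv (y_ n).1) (wderiv y.1).
  move=> cy; apply: (dot_cvg_le _ cy) => n.
  by rewrite -wderivB; have [] := normX_ge (y_ n - y).
have compV (y_ : nat -> X) y : dot_cvg (dotX m) y_ y ->
    dot_cvg dotL2 (fun n => (y_ n).2) y.2.
  by move=> cy; apply: (dot_cvg_le _ cy) => n; have [] := normX_ge (y_ n - y).
have /choice[v' /choice[w'' vw]] : forall n, exists v' w'' : L2,
    weak_derivative (z_ n).2 v' /\ weak_derivative (wderiv (z_ n).1 + v') w''.
  by move=> n; exact: opA_domP.
have eA n := opA_domI (vw n).1 (vw n).2.
have A1 n : H1val (opA m (z_ n)).1 = (z_ n).2 by case: (eA n).
have v2 : z.2 = H1val w.1.
  apply: (dot_cvg_unique ip (compV _ _ cz)).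
  have := compU _ _ cA; rewrite /dot_cvg.
  by under eq_fun do rewrite /= A1.
have cv' : dot_cvg dotL2 v' (wderiv w.1).
  suff -> : v' = fun n => wderiv (H1val ((opA m \o z_) n).1) by exact: compU'.
  by apply/funext => n /=; rewrite A1 (wderivE (vw n).1).
have cw'' : dot_cvg dotL2 w'' (m%:C *: H1val z.1 + w.2).
  suff -> : w'' = fun n => m%:C *: H1val (z_ n).1 + ((opA m \o z_) n).2.
    exact: (dot_cvg_lin ip m%:C (compU _ _ cz) (compV _ _ cA)).
  apply/funext => n; have [_ _ e2] := eA n.
  have -> : ((opA m \o z_) n).2 = (opA m (z_ n)).2 by [].
  by rewrite e2 addrC subrK.
have zv : weak_derivative z.2 (wderiv w.1) by rewrite v2; exact: H1_wderiv.
have zw : weak_derivative (wderiv z.1 + wderiv w.1) (m%:C *: H1val z.1 + w.2).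
  apply: (weak_derivative_closed (fun n => (vw n).2) _ cw'').
  exact: (dot_cvgD ip (compU' _ _ cz) cv').
have [d e1 e2] := opA_domI zv zw; split => //.
rewrite [LHS]surjective_pairing [RHS]surjective_pairing; congr pair.
  by apply: val_inj; rewrite [LHS]e1 v2.
by rewrite e2 addrAC subrr add0r.
Qed.

Lemma opA_kernel (l : R[i]) (z : X) : Re l = 0 -> dom (opA m) z ->
  opA m z = l *: z -> z = 0.
Proof.
move=> l0 /opA_domP[v' [w'' [vv' ww'']]] ez.
have [_ e1 e2] := opA_domI vv' ww''.
have zv : z.2 = l *: H1val z.1 by rewrite -e1 ez.
have zv' : v' = l *: wderiv z.1.
  apply: (weak_derivative_unique vv'); rewrite zv.
  have e (x : L2) : (l - 1) *: x + x = l *: x by rewrite scalerBl scale1r subrK.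
  by rewrite -!e; apply: weak_derivative_lin; exact: H1_wderiv.
have ew : w'' - m%:C *: H1val z.1 = l *: z.2 by rewrite -e2 ez.
have orth (x : L2) : rd x (l *: x) = 0 by rewrite (rdotC ip) (rdot_scale_self ip) l0 mul0r.
have v'0 : v' = 0.
  apply: (inner_eq0 ip); have := dissipation vv' ww''.
  (* As v = l u and v' = l u' with l imaginary, both cross terms vanish. *)
  rewrite ew (rdot_scale_self ip) l0 mul0r {1}zv' orth zv orth.
  by rewrite -/(rd v' v'); lra.
have v0 : z.2 = 0.
  by apply: (@weak_derivative_eigen_eq0 _ z.2 0); rewrite scale0r -v'0.
have u0 : H1val z.1 = 0.
  (* For l = 0 the relation v = l u carries no information on u. Instead u'' = m u, and pairing with
     u gives m <u, u> + <u', u'> = 0. *)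
  have [l00|lN0] := eqVneq l 0; last first.
    by move/eqP : zv; rewrite v0 eq_sym scaler_eq0 (negbTE lN0) => /eqP.
  rewrite v'0 addr0 in ww''.
  have wE : w'' = m%:C *: H1val z.1 by apply/subr0_eq; rewrite ew l00 scale0r.
  have := weak_skew ww'' (H1_wderiv z.1); rewrite wE (rdotZl ip) => e.
  apply: (inner_eq0 ip); rewrite -/(rd (H1val z.1) (H1val z.1)).
  have h1 := rdot_ge0 ip (H1val z.1); have h2 := rdot_ge0 ip (wderiv z.1).
  by apply/eqP; rewrite eq_le h1 andbT -(pmulr_rle0 _ m_gt0); lra.
by rewrite [LHS]surjective_pairing v0; congr pair; exact: val_inj.
Qed.

(* Factor [c - D^2] as [(k - D) (k + D)] with [k^2 = c]. *)
Lemma helmholtz_onto (c : R[i]) : Re (sqrtc c) != 0 ->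
  exists C : R, forall h : L2, exists w w' : L2,
    [/\ weak_derivative w w', weak_derivative w' (c *: w - h),
        norm w <= C * norm h & norm w' <= C * norm h].
Proof.
set k := sqrtc c => k0; have kk : k * k = c by rewrite -expr2 sqr_sqrtc.
set r := `|Re k|; have r0 : 0 < r by rewrite normr_gt0.
pose N := Normc.normc k.
have N0 : 0 <= N by rewrite /N; case: (k) => a b; exact: sqrtr_ge0.
(* The bounds for w and for w' = y - k w are added, so that one constant serves both. *)
exists (r^-1 ^+ 2 + (r^-1 + N * r^-1 ^+ 2)) => h.
(* y solves y' - k y = -h, and then w solves w' + k w = y; hence w'' = -k w' + y' = c w - h. *)
have [|y [y' [yy' eh ley]]] := @weak_onto R (- k) (- h).
  by case: (k) k0 => a b /=; rewrite oppr_eq0.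
have {}ley : norm y <= r^-1 * norm h.
  rewrite ler_pdivlMl//; move: ley; rewrite (normN ip).
  by rewrite /r; case: (k) => a b /=; rewrite normrN.
have [w [w' [ww' ey lew]]] := weak_onto y k0.
have {}lew : norm w <= r^-1 ^+ 2 * norm h.
  rewrite -(ler_pdivlMl _ _ r0) in lew; apply: le_trans lew _.
  by rewrite expr2 -mulrA ler_wpM2l// invr_ge0 ltW.
have w'E : w' = (- k) *: w + y by rewrite -ey scaleNr addrCA addNr addr0.
have n0 (x : L2) : 0 <= norm x by exact: norm_ge0.
have ri : 0 <= r^-1 by rewrite invr_ge0 ltW.
have lew' : norm w' <= (r^-1 + N * r^-1 ^+ 2) * norm h.
  rewrite w'E scaleNr (le_trans (normD ip _ _))// (normN ip) (normZ ip).
  by rewrite [leLHS]addrC mulrDl lerD// -mulrA ler_wpM2l.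
exists w, w'; split => //.
- have -> : c *: w - h = (- k) *: w' + y'.
    by rewrite -eh w'E scalerDr scalerA mulNr mulrN opprK kk scaleNr addrCA [in RHS]addrC.
  by rewrite {1}w'E; exact: weak_derivative_lin.
- by rewrite (le_trans lew)// ler_wpM2r// lerDl addr_ge0// mulr_ge0// sqr_ge0.
- by rewrite (le_trans lew')// ler_wpM2r// lerDr sqr_ge0.
Qed.

(** The square of a purely imaginary number is a nonpositive real. *)
Lemma Re_sqrtc_eq0 (c : R[i]) : Re (sqrtc c) = 0 -> Im c = 0 /\ Re c <= 0.
Proof.
rewrite -{2 3}(sqr_sqrtc c) expr2; case: (sqrtc c) => a b /= ->.
by rewrite !mul0r mulr0 addr0 sub0r oppr_le0 -expr2 sqr_ge0.
Qed.

(** The solution is rebuilt from w as u = (w + f) / (1 + l) and v = l u - f, so that u + v = w and v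
    inherits a weak derivative from u and f. *)
Lemma opA_onto (l : R[i]) : 1 + l != 0 ->
  Re (sqrtc ((l ^+ 2 + m%:C) / (1 + l))) != 0 ->
  exists C : R, forall z : X, exists x : X,
    [/\ dom (opA m) x, l *: x - opA m x = z & normX x <= C * normX z].
Proof.
set c := _ / _ => l1 /helmholtz_onto[C0 onto].
have ec : c * (1 + l) = l ^+ 2 + m%:C by rewrite /c divfK.
pose nc := @Normc.normc R.
have nc0 k : 0 <= nc k by case: k => a b; exact: sqrtr_ge0.
have sm : 0 < Num.sqrt m by rewrite sqrtr_gt0.
set s := Num.sqrt m in sm; set p := (1 + l)^-1.
pose C := `|C0|.
(* K controls the right-hand side (l - c) f + g, using that the norm of f is at most that of z over
   sqrt m; U controls u. *)
pose K := nc (l - c) * s^-1 + 1.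
pose U := nc p * (C * K + s^-1).
exists (s * U + nc p * (C * K + 1) + (nc l * U + s^-1)) => z.
set N := normX z; have [f1 f2 f3] := normX_ge z; rewrite -/s -/N in f1 f2 f3.
have {}f1 : norm (H1val z.1) <= s^-1 * N by rewrite ler_pdivlMl.
set f := H1val z.1 in f1; set f' := wderiv z.1 in f2; set g := z.2 in f3.
have [w [w' [ww' ww'' lew lew']]] := onto ((l - c) *: f + g).
have n0 (x : L2) : 0 <= norm x by exact: norm_ge0.
have ff' : weak_derivative f f' := H1_wderiv z.1.
have leh : norm ((l - c) *: f + g) <= K * N.
  rewrite (le_trans (normD ip _ _))// (normZ ip) mulrDl mul1r lerD//.
  by rewrite -mulrA ler_wpM2l// nc0.
have leCh : C0 * norm ((l - c) *: f + g) <= C * K * N.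
  rewrite -mulrA (le_trans (ler_wpM2r (n0 _) (ler_norm C0)))//.
  by rewrite ler_wpM2l.
have {}lew := le_trans lew leCh; have {}lew' := le_trans lew' leCh.
pose u0 : L2 := p *: (w + f); pose u' : L2 := p *: (w' + f').
have wder0 : weak_derivative (0 : L2) 0.
  have := H1_wderiv (0 : H1); rewrite (_ : wderiv _ = 0)//.
  by have := wderivB (0 : H1) 0; rewrite !subrr.
have uu' : weak_derivative u0 u'.
  rewrite /u0 /u' -[_ *: (w + f)]addr0 -[_ *: (w' + f')]addr0.
  apply: weak_derivative_lin => //; rewrite -[w]scale1r -[w']scale1r.
  exact: weak_derivative_lin.
have uH : u0 \in @H1_pred R by apply/asboolP; exists u'.
pose u : H1 := MkH1 uH.
have uE : wderiv u = u' := wderivE uu'.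
pose v : L2 := l *: u0 - f.
have vv' : weak_derivative v (l *: u' - f').
  have := weak_derivative_lin (-1) ff' (weak_derivative_lin l uu' wder0).
  by rewrite !addr0 !scaleN1r addrC [X in weak_derivative _ X]addrC.
have pl (x : L2) : p *: x + l *: (p *: x) = x.
  by rewrite scalerA -scalerDl -{1}[p]mul1r -mulrDl divff// scale1r.
have uv' : wderiv u + (l *: u' - f') = w'.
  by rewrite uE /u' addrA pl addrK.
have uvww : weak_derivative (wderiv u + (l *: u' - f')) (c *: w - ((l - c) *: f + g)).
  by rewrite uv'.
have [] := @opA_domI (u, v) _ _ vv' uvww.
move=> d e1 e2; exists (u, v); split => //.
- rewrite [LHS]surjective_pairing [RHS]surjective_pairing; congr pair.
    apply: val_inj; rewrite -[RHS]/f -[LHS]/(l *: u0 - H1val (opA m (u, v)).1) e1.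
    by rewrite /v /= subKr.
  rewrite -[LHS]/(l *: v - (opA m (u, v)).2) e2 -/g /=.
  (* Since c (1 + l) = l^2 + m and (1 + l) u = w + f. *)
  have cwf : c *: w + c *: f = (l ^+ 2 + m%:C) *: u0.
    by rewrite -ec -scalerDr /u0 [in RHS]scalerA mulfK.
  have -> : c *: w - ((l - c) *: f + g) = l *: v - g + m%:C *: u0.
    rewrite /v scalerBl !scalerBr scalerA -expr2 !opprD opprK addrA.
    rewrite [c *: w + _]addrCA cwf scalerDl.
    rewrite !addrA [_ + l ^+ 2 *: u0]addrC -[in RHS]addrA [- g + _]addrC addrA.
    by rewrite [_ - _ + m%:C *: u0]addrAC.
  by rewrite addrK subKr.
- rewrite (le_trans (normX_le _))//= uE -/s.
  have leu : norm u0 <= U * N.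
    rewrite /u0 (normZ ip) -mulrA ler_wpM2l ?nc0//.
    by rewrite (le_trans (normD ip _ _))// mulrDl lerD.
  rewrite 2!mulrDl lerD ?lerD//.
  + by rewrite -mulrA ler_wpM2l// ltW.
  + rewrite /u' (normZ ip) -mulrA ler_wpM2l ?nc0//.
    by rewrite (le_trans (normD ip _ _))// mulrDl mul1r lerD.
  + rewrite /v (le_trans (normB_le ip _ _))// (normZ ip) mulrDl lerD//.
    by rewrite -mulrA ler_wpM2l ?nc0//.
Qed.

(** The first component forces v = l u; the second then reads w'' = (l^2 + m) u - b = -b, so -(u +
    v) would have the bump b as second weak derivative. *)
Lemma opA_not_onto (l : R[i]) : l ^+ 2 + m%:C = 0 ->
  ~ exists x, dom (opA m) x /\ l *: x - opA m x = (0, testL2 (@test_bump01 R)).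
Proof.
set b := testL2 _ => l2 [x [/opA_domP[v' [w'' [vv' ww'']]] ex]].
have [_ e1 e2] := opA_domI vv' ww''.
have ev : l *: H1val x.1 - x.2 = 0.
  by rewrite -e1 -[LHS]/(H1val (l *: x - opA m x).1) ex.
have ew : l *: x.2 - (opA m x).2 = b by rewrite -[LHS]/((l *: x - opA m x).2) ex.
have wb : w'' = - b.
  rewrite -ew e2 -(subr0_eq ev) scalerA -expr2 opprB -addrA -opprD -scalerDl.
  by rewrite [m%:C + _]addrC l2 scale0r subr0.
have uv : weak_derivative (H1val x.1 + x.2) (wderiv x.1 + v').
  by have := weak_derivative_lin 1 (H1_wderiv x.1) vv'; rewrite !scale1r.
have neg (f g : L2) : weak_derivative f g -> weak_derivative (- f) (- g).
  move=> fg; have := weak_derivative_lin (-2) fg fg.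
  have e (y : L2) : (-2) *: y + y = - y.
    by rewrite scaleNr scaler_nat mulr2n opprD subrK.
  by rewrite !e.
move/neg : uv; move/neg : ww''; rewrite wb opprK => h1 h2.
exact: bump_not_second_derivative h2 h1.
Qed.

(** For l = i y the quotient is (m - y^2) (1 - i y) / (1 + y^2). As y^2 differs from m, it is real
    only for y = 0, where it equals m > 0; so it is never a nonpositive real. *)
Lemma imaginary_cancel (l : R[i]) : Re l = 0 -> l ^+ 2 + m%:C != 0 ->
  1 + l != 0 /\ Re (sqrtc ((l ^+ 2 + m%:C) / (1 + l))) != 0.
Proof.
case: l => a y a0; have -> : a = 0 := a0; move=> lm.
have y1 : 1 + y ^+ 2 != 0 by rewrite lt0r_neq0// ltr_pwDl// sqr_ge0.
have l1 : 1 + (0 +i* y) != 0 by rewrite eq_complex /= addr0 oner_eq0.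
have my : m - y ^+ 2 != 0.
  apply: contra_neq lm => my; apply/eqP; rewrite eq_complex /=.
  apply/andP; split; apply/eqP; first by rewrite -[RHS]my; ring.
  by ring.
split => //; apply/eqP => /Re_sqrtc_eq0.
have -> : ((0 +i* y) ^+ 2 + m%:C) / (1 + (0 +i* y)) =
    ((m - y ^+ 2) / (1 + y ^+ 2)) +i* (- ((m - y ^+ 2) / (1 + y ^+ 2) * y)).
  apply: (mulIf l1); rewrite divfK//.
  by apply/eqP; rewrite eq_complex /=; apply/andP; split; apply/eqP; field.
move=> /= [/eqP]; rewrite oppr_eq0 mulf_eq0 mulf_eq0 invr_eq0 (negbTE my) (negbTE y1) /=.
by move=> /eqP ->; rewrite expr0n subr0 addr0 divr1 leNgt m_gt0.
Qed.

Lemma imaginary_axis_root (l : R[i]) : l ^+ 2 + m%:C = 0 <->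
  l = 'i%C * (Num.sqrt m)%:C \/ l = - ('i%C * (Num.sqrt m)%:C).
Proof.
have -> : l ^+ 2 + m%:C = (l - 'i * (Num.sqrt m)%:C) * (l + 'i * (Num.sqrt m)%:C).
  rewrite -subr_sqr exprMn sqr_i mulN1r opprK -rmorphXn.
  by rewrite sqr_sqrtr// ltW.
split=> [/eqP|[->|->]]; last 2 first.
- by rewrite subrr mul0r.
- by rewrite addNr mulr0.
by rewrite mulf_eq0 subr_eq0 addr_eq0 => /orP[]/eqP; [left|right].
Qed.

End DampedWaveOperator.

Theorem theorem2p1 (R : realType) (m : R) (m_gt0 : 0 < m) :
  [/\ closed_operator (dotX m) (opA m),
      dissipative (dotX m) (opA m),
      spectrum (dotX m) (opA m) `&` imaginary_axis R =
        [set 'i%C * (Num.sqrt m)%:C; - ('i%C * (Num.sqrt m)%:C)] &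
      point_spectrum (opA m) `&` imaginary_axis R = set0].
Proof.
split.
- exact: opA_closed.
- exact: opA_dissipative.
- apply/seteqP; split => l /=.
    move=> [sl l0]; apply/(imaginary_axis_root m_gt0); apply: contrapT => /eqP lm.
    have [l1 k0] := imaginary_cancel m_gt0 l0 lm; apply: sl.
    have [C onto] := opA_onto m_gt0 l1 k0.
    apply: (resolvent_of_onto (M := C)) => //.
      by move=> a x y; exact: opA_lin.
    by move=> x; exact: opA_kernel.
  move=> lE; split; last first.
    by case: lE => ->; rewrite /imaginary_axis /=; ring.
  (* The right inverse [S] would produce a preimage of (0, b). *)
  move=> [S [_ SA _]]; apply: (@opA_not_onto _ m l).
    exact/(imaginary_axis_root m_gt0).
  by exists (S (0, testL2 (@test_bump01 R))).
- apply/seteqP; split => // l [[z [dz z0 ez]] l0].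
  by move/negP : z0; apply; apply/eqP; exact: (opA_kernel m_gt0 l0 dz ez).
Qed.
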